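(* Assume (F0)–(F5). Let $t\in[0,T]$ be fixed and assume that there exist $u,v\in\mathcal{C}(t)$ such that $$F_t(u)-F_t(v)=c_t(u,v),$$ where $c_t$ is the energy-dissipation cost. Then there exist a set of distinct points $\{u^0,u^1,\dots,u^m\}\subseteq\mathcal{C}(t)$ with $u^0=u$, $u^m=v$, and a family of functions $(v^i)_{i=1,\dots,m}$, $v^i:\mathbb{R}\to X$, such that for every $i=1,\dots,m$: $$A\ddot v^i(s)+B\dot v^i(s)+\nabla_xF_t(v^i(s))=0\quad\text{for all }s\in\mathbb{R},$$ $$\lim_{s\to-\infty}v^i(s)=u^{i-1},\qquad\lim_{s\to+\infty}v^i(s)=u^i,\qquad\lim_{s\to\pm\infty}\dot v^i(s)=0.$$
   Context: Setting: $T>0$; $(X,\|\cdot\|)$ is a Euclidean space of dimension $n\ge1$ with inner product $\langle\cdot,\cdot\rangle$; $A,B:X\to X$ are symmetric, positive definite linear operators; $F:[0,T]\times X\to\mathbb{R}$, and $F_t(\cdot):=F(t,\cdot)$. For a symmetric positive definite operator $Q$, $\|u\|_Q:=\langle u,Qu\rangle^{1/2}$. $B_M$ is the closed ball of radius $M$ centered at $0$. Energy-dissipation cost: for $t\in[0,T]$ and $u_1,u_2\in X$, $$c_t(u_1,u_2):=\inf\Big\{\frac12\int_{-N}^{N}\|\nabla_xF_t(w(s))+A\ddot w(s)\|_{B^{-1}}^2+\|\dot w(s)\|_B^2\,ds:\ w\in V^{t,N}_{u_1,u_2},\ N\in\mathbb{N}\Big\},$$ $$V^{t,N}_{u_1,u_2}:=\{w\in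 W^{2,2}([-N,N],X):w(-N)=u_1,\ w(N)=u_2,\ \dot w(-N)=\dot w(N)=0\}.$$ Assumptions on $F$: (F0) $F\in C^1([0,T]\times X)$. (F1) For every $\rho>0$ the set $\{u\in X:\sup_{t\in[0,T]}|F(t,u)|\le\rho\}$ is bounded. (F2) There exist $C_1,C_2>0$ with $|\partial_tF(t,u)|\le C_1F(t,u)+C_2$ for all $(t,u)\in[0,T]\times X$. (F3) For every $M>0$ there is $a_M\in L^1(0,T)$ such that $|\partial_t\nabla_xF(t,u)|\le a_M(t)$ for every $t\in[0,T]$ and $u\in B_M$. (F4) $F(t,\cdot)\in C^2(X)$ for every $t\in[0,T]$ and the Hessian $\nabla_x^2F(t,u)$ is continuous on $[0,T]\times X$. (F5) For every $t\in[0,T]$ the critical set $\mathcal{C}(t):=\{u\in X:\nabla_xF(t,u)=0\}$ consists of isolated points. *)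

(* Defs.v *)
From HB Require Import structures.
From mathcomp Require Import all_boot all_order all_algebra.
From mathcomp Require Import all_classical all_reals all_analysis.

Set Implicit Arguments.
Unset Strict Implicit.
Unset Printing Implicit Defensive.

Import Order.TTheory GRing.Theory Num.Theory.
Import numFieldNormedType.Exports.

Local Open Scope classical_set_scope.
Local Open Scope ring_scope.

(* The Euclidean space of dimension n.+1 is 'cV[R]_n.+1 with the standard inner
   product [dot].  MathComp-Analysis puts the sup norm on matrices: it is used
   only for topological notions (limits, continuity, differentiability,
   boundedness); the Euclidean norm is [enorm], the weighted norms are [qnorm]. *)

Section Euclidean.
Context {R : realType} {n : nat}.
Implicit Types (x y : 'cV[R]_n.+1) (Q : 'M[R]_n.+1) (f : 'cV[R]_n.+1 -> R).

Definition dot x y : R := \sum_i x i 0 * y i 0.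

Definition qnorm Q x : R := Num.sqrt (dot x (Q *m x)).

Definition enorm x : R := Num.sqrt (dot x x).

Definition sym_posdef Q : Prop :=
  Q^T = Q /\ forall x, x != 0 -> 0 < dot x (Q *m x).

Definition grad f x : 'cV[R]_n.+1 := \col_i 'D_(delta_mx i 0) f x.

Definition hess f x : 'M[R]_n.+1 :=
  \matrix_(i, j) 'D_(delta_mx j 0) (fun y => grad f y i 0) x.

Definition C2 f : Prop :=
  [/\ forall x, differentiable f x,
      forall x, differentiable (grad f) x
    & continuous (hess f)].

End Euclidean.

(* Derivative of g at t relative to D; on D = [0, T] it is one-sided at the
   endpoints, so values of g outside [0, T] are irrelevant. *)
Section DerivativeWithin.
Context {R : realType} {V : normedModType R}.
Implicit Types (D : set R) (g : R -> V) (t : R).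

Definition difference_quotient g t : R -> V :=
  fun s => (s - t)^-1 *: (g s - g t).

Definition derivable_within D g t : Prop :=
  cvg (difference_quotient g t @ within D t^').

Definition derive_within D g t : V :=
  lim (difference_quotient g t @ within D t^').

End DerivativeWithin.

(* F : [0, T] x X -> R is represented by a function on R x X of which only the
   values at times in [0, T] are ever used. *)
Section Assumptions.
Context {R : realType} {n : nat}.
Variables (T : R) (F : R -> 'cV[R]_n.+1 -> R).

Let I : set R := `[0, T].

Definition dt_F (t : R) (u : 'cV[R]_n.+1) : R :=
  derive_within I (fun s => F s u) t.

Definition dt_grad_F (t : R) (u : 'cV[R]_n.+1) : 'cV[R]_n.+1 :=
  derive_within I (fun s => grad (F s) u) t.

Definition critical (t : R) : set 'cV[R]_n.+1 :=
  [set u | grad (F t) u = 0].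

Definition F0 : Prop :=
  [/\ {within I `*` setT, continuous (fun p : R * 'cV[R]_n.+1 => F p.1 p.2)},
      forall t u, I t ->
        derivable_within I (fun s => F s u) t /\ differentiable (F t) u,
      {within I `*` setT, continuous (fun p : R * 'cV[R]_n.+1 => dt_F p.1 p.2)}
    & {within I `*` setT,
        continuous (fun p : R * 'cV[R]_n.+1 => grad (F p.1) p.2)}].

Definition F1 : Prop :=
  forall rho : R, 0 < rho ->
    bounded_set [set u : 'cV[R]_n.+1 |
      (ereal_sup [set (`|F t u|)%:E | t in I] <= rho%:E)%E].

Definition F2 : Prop :=
  exists C1 C2 : R, [/\ 0 < C1, 0 < C2
    & forall t u, I t -> `|dt_F t u| <= C1 * F t u + C2].

Definition F3 : Prop :=
  forall M : R, 0 < M ->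
    exists2 a : R -> R,
      (@lebesgue_measure R).-integrable `]0, T[ (EFin \o a)
    & forall t u, I t -> enorm u <= M ->
        derivable_within I (fun s => grad (F s) u) t /\
        enorm (dt_grad_F t u) <= a t.

Definition F4 : Prop :=
  (forall t, I t -> C2 (F t)) /\
  {within I `*` setT,
    continuous (fun p : R * 'cV[R]_n.+1 => hess (F p.1) p.2)}.

Definition F5 : Prop :=
  forall t, I t -> critical t `<=` isolated (critical t).

End Assumptions.

Section Sobolev.
Context {R : realType}.
Implicit Types (a b : R) (f g phi : R -> R).
Local Notation mu := (@lebesgue_measure R).

(* phi is of class C^1 with compact support inside ]a, b[. *)
Definition test_function a b phi : Prop :=
  [/\ forall x, derivable phi x 1,
      continuous (derive1 phi),
      compact (closure [set x | phi x != 0])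
    & closure [set x | phi x != 0] `<=` `]a, b[].

Definition L2 a b f : Prop :=
  measurable_fun `]a, b[ f /\
  mu.-integrable `]a, b[ (fun x => (f x ^+ 2)%:E).

Definition weak_derivative a b f g : Prop :=
  forall phi, test_function a b phi ->
    \int[mu]_(x in `]a, b[) (f x * derive1 phi x) =
    - \int[mu]_(x in `]a, b[) (g x * phi x).

(* f belongs to W^{1,2}(a, b) and g represents its weak derivative. *)
Definition W12 a b f g : Prop :=
  [/\ L2 a b f, L2 a b g & weak_derivative a b f g].

(* w belongs to W^{2,2}([a, b], R^n.+1), with first and second weak derivatives
   dw and ddw.  Continuity selects the continuous representatives of w and of
   its first derivative, so that their values at a and b are meaningful; ddw is
   an arbitrary representative. *)
Definition W22 (n : nat) a b (w dw ddw : R -> 'cV[R]_n.+1) : Prop :=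
  [/\ {within `[a, b], continuous w},
      {within `[a, b], continuous dw}
    & forall i, W12 a b (fun s => w s i 0) (fun s => dw s i 0) /\
                W12 a b (fun s => dw s i 0) (fun s => ddw s i 0)].

End Sobolev.

Section Cost.
Context {R : realType} {n : nat}.
Variables (A B : 'M[R]_n.+1) (f : 'cV[R]_n.+1 -> R).
Implicit Types (N : nat) (u : 'cV[R]_n.+1) (w dw ddw : R -> 'cV[R]_n.+1).

Definition admissible N u1 u2 w dw ddw : Prop :=
  [/\ W22 (- N%:R) N%:R w dw ddw,
      w (- N%:R) = u1, w N%:R = u2,
      dw (- N%:R) = 0 & dw N%:R = 0].

Definition lagrangian w dw ddw (s : R) : R :=
  qnorm (invmx B) (grad f (w s) + A *m ddw s) ^+ 2 + qnorm B (dw s) ^+ 2.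

Definition action N w dw ddw : \bar R :=
  ((2^-1)%:E * \int[@lebesgue_measure R]_(s in `[(- N%:R)%R, N%:R%R])
     (lagrangian w dw ddw s)%:E)%E.

(* The cost c_t is [cost A B (F t)].  The half-length N ranges over the positive
   integers, since W^{2,2}([-N, N]) presupposes a nondegenerate interval. *)
Definition cost u1 u2 : \bar R :=
  ereal_inf [set c | exists N w dw ddw,
    [/\ (0 < N)%N, admissible N u1 u2 w dw ddw & c = action N w dw ddw]].

End Cost.

(* Main.v *)
(** Write [E(x, q) = f x + <q, A q> / 2]. For an admissible [w] with residual
    [g = grad f(w) + A w'' + B w'], completing the square in the action and using
    [E(w, w')' = <g - B w', w'>] gives
      action = f u - f v + 1/2 int <g, B^-1 g>.
    Hence [c(u, v) = f u - f v] provides approximate solutions of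
    [A w'' + B w' + grad f(w) = 0], resting at [u] before and at [v] after a bounded
    time interval, with arbitrarily small residual in L^2, along which [E] is almost
    nonincreasing; (F1) and (F2) keep them in a fixed compact set.

    In phase space this is a first-order system [z' = G z] with strict Lyapunov
    function [E], and pointwise ultralimits of such pseudo-orbits are genuine
    trajectories on the whole line. Translating time so that time 0 is the exit from a
    small ball around an equilibrium [d], the limit is a trajectory which stays near [d]
    in the past. By LaSalle's argument and the isolation of equilibria it tends to [d] at
    -oo and to an equilibrium [d'] with [E d' < E d] at +oo. Cutting the approximating
    pseudo-orbits where they pass near [d'], and jumping there from rest at [d'], shows
    that pseudo-orbits also join [d'] to [v], so one can iterate. The iteration stops
    because a compact set contains only finitely many equilibria. *)

Require Import Defs.
From HB Require Import structures.
From mathcomp Require Import all_boot all_order all_algebra.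
From mathcomp Require Import all_classical all_reals all_analysis.
From mathcomp Require Import measurable_realfun ring lra.

Set Implicit Arguments.
Unset Strict Implicit.
Unset Printing Implicit Defensive.

Import Order.TTheory GRing.Theory Num.Theory.
Import numFieldNormedType.Exports.

Local Open Scope classical_set_scope.
Local Open Scope ring_scope.

Section Compactness.
Implicit Types T : topologicalType.

Lemma ultra_cvg_compact (I : Type) T (U : set_system I) (K : set T) (h : I -> T) :
  UltraFilter U -> compact K -> (forall i, K (h i)) ->
  exists2 l, K l & h i @[i --> U] --> l.
Proof.
move=> U_ultra Kc hK.
have UhK : (h i @[i --> U]) K by rewrite /= nbhs_filterE; apply: filterE.
have [l [Kl l_cluster]] := Kc _ _ UhK.
exists l => // N Nl.
have [//|UNC] := in_ultra_setVsetC (h @^-1` N) U_ultra.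
by have [x [/= xN Nx]] := l_cluster (~` N) N UNC Nl.
Qed.

Lemma cvg_ultra (I : Type) T (F : set_system I) (h : I -> T) (l : T) : Filter F ->
  (forall U, UltraFilter U -> F `<=` U -> h i @[i --> U] --> l) ->
  h i @[i --> F] --> l.
Proof.
move=> F_filter ultra_l N Nl; apply: contrapT => nFN.
have W_proper : ProperFilter (within (~` (h @^-1` N)) F).
  apply: Build_ProperFilter => W0; apply: nFN; move: W0.
  rewrite /= /fmap /within /=; apply: filterS => i /= Ni.
  by apply: contrapT => /Ni.
have [U [U_ultra WU]] := ultraFilterLemma W_proper.
have UN : U (h @^-1` N).
  by apply: (ultra_l U) => // D FD; apply: WU; rewrite /within /=; exact: filterS FD.
have UNC : U (~` (h @^-1` N)) by apply: WU; exact: withinT.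
by have /filter_ex[i []] : U (h @^-1` N `&` ~` (h @^-1` N)) by exact: filterI.
Qed.

Lemma isolated_compact_repeat T (K C : set T) (x : nat -> T) :
  compact K -> closed C -> C `<=` isolated C ->
  (forall k, K (x k)) -> (forall k, C (x k)) ->
  exists i j, (i < j)%N /\ x i = x j.
Proof.
move=> Kc Ccl Ciso Kx Cx.
have [U [U_ultra sU]] := ultraFilterLemma (@eventually_filter).
have [c Kc' xc] := ultra_cvg_compact U_ultra Kc Kx.
have Cc : C c by exact: (closed_cvg C Ccl (filterE _ Cx) c xc).
have [_ [N Nc NC]] := Ciso c Cc.
have Uxc : U [set k | x k = c].
  have UN : U [set k | N (x k)] by exact: xc.
  by apply: filterS UN => k /= Nxk; suff : [set c] (x k) by []; rewrite -NC.
have [i xi] := filter_ex Uxc.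
have Ui : U [set k | (i < k)%N] by apply: sU; exact: nbhs_infty_gt.
have [j [/= xj ij]] := filter_ex (filterI Uxc Ui).
by exists i, j; rewrite xi xj.
Qed.

Lemma isolated_norm (R : realType) (V : normedModType R) (C : set V) (x : V) :
  isolated C x -> exists2 r, 0 < r & forall y, `|y - x| <= r -> C y -> y = x.
Proof.
move=> [_ [N /nbhs_ballP[r r0 rN] NC]].
exists (r / 2); first by rewrite divr_gt0.
move=> y yx Cy; suff : [set x] y by [].
rewrite -NC; split => //; apply: rN.
rewrite -ball_normE /ball_/= distrC; apply: le_lt_trans yx _.
by rewrite ltr_pdivrMr// ltr_pMr// ltr1n.
Qed.

Lemma compact_uniform_continuous (R : realType) (V V' : normedModType R)
    (K : set V) (h : V -> V') (e : R) :
  compact K -> {within K, continuous h} -> 0 < e ->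
  exists2 r, 0 < r & forall x y, K x -> K y -> `|x - y| <= r -> `|h x - h y| <= e.
Proof.
move=> Kc /subspace_continuousP hc e0; apply: contrapT => no_modulus.
have inv_gt0 (k : nat) : 0 < k.+1%:R^-1 :> R by rewrite invr_gt0.
have /choice[z zP] : forall k : nat, exists z : V * V,
    [/\ K z.1, K z.2, `|z.1 - z.2| <= k.+1%:R^-1 & e < `|h z.1 - h z.2|].
  move=> k; apply: contrapT => nz; apply: no_modulus; exists k.+1%:R^-1 => // x y Kx Ky xy.
  by rewrite leNgt; apply/negP => exy; apply: nz; exists (x, y).
have [U [U_ultra sU]] := ultraFilterLemma (@eventually_filter).
have Kz1 k : K (z k).1 by have [] := zP k.
have Kz2 k : K (z k).2 by have [] := zP k.
have [x Kx z1x] := ultra_cvg_compact U_ultra Kc Kz1.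
have z12 : ((z k).1 - (z k).2) @[k --> U] --> (0 : V).
  apply/cvgr0Pnorm_le => d d0.
  have : U [set k : nat | k.+1%:R^-1 < d].
    by apply: sU; exact: near_infty_natSinv_lt (PosNum d0).
  by apply: filterS => k /ltW; have [_ _ + _] := zP k => /le_trans; exact.
have z2x : (z k).2 @[k --> U] --> x.
  rewrite (_ : (fun k => (z k).2) = fun k => (z k).1 - ((z k).1 - (z k).2)).
    by rewrite -[x in _ --> x]subr0; exact: cvgB.
  by apply/funext => k; rewrite subKr.
have h_cvg (y : nat -> V) : (forall k, K (y k)) -> y k @[k --> U] --> x ->
    h (y k) @[k --> U] --> h x.
  move=> Ky yx N Nhx.
  have UN : U [set k | K (y k) -> N (h (y k))] by exact: yx (hc x Kx N Nhx).
  suff : U [set k | N (h (y k))] by [].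
  by apply: filterS UN => k; exact.
have hz : `|h (z k).1 - h (z k).2| @[k --> U] --> `|h x - h x|.
  by apply: cvg_norm; apply: cvgB; exact: h_cvg.
have : e <= `|h x - h x|.
  by apply: (cvgr_to_ge hz); apply: filterE => k; have [_ _ _ /ltW] := zP k.
by rewrite subrr normr0 leNgt e0.
Qed.

Lemma continuous_bounded_on_compact (R : realType) (V V' : normedModType R)
    (K : set V) (h : V -> V') :
  compact K -> {within K, continuous h} ->
  exists2 C, 0 <= C & forall x, K x -> `|h x| <= C.
Proof.
move=> Kc hc; have [M [_ hM]] := compact_bounded (continuous_compact hc Kc).
exists (`|M| + 1) => [|x Kx]; first by rewrite addr_ge0.
apply: (hM (`|M| + 1)); last by exists x.
by rewrite (le_lt_trans (ler_norm _))// ltrDl.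
Qed.

Lemma ler_cvg_filter (R : realType) (I : Type) (F : set_system I) (g h : I -> R) (a b : R) :
  ProperFilter F -> g i @[i --> F] --> a -> h i @[i --> F] --> b ->
  (forall i, g i <= h i) -> a <= b.
Proof.
move=> F_proper ga hb gh; rewrite -subr_le0.
by apply: (cvgr_to_le (cvgB ga hb)); apply: nearW => i; rewrite subr_le0.
Qed.

End Compactness.

Section RealFunctionsAtInfinity.
Context {R : realType}.
Implicit Types (g : R -> R) (F : set_system R).

Definition translation_invariant F := forall s : R, (t + s) @[t --> F] --> F.

Lemma translation_invariant_pinfty : translation_invariant (pinfty_nbhs R).
Proof.
move=> s N [a [_ aN]]; exists (a - s); split; first exact: num_real.
by move=> t ast; apply: aN; rewrite -ltrBlDr.
Qed.

Lemma translation_invariant_ninfty : translation_invariant (ninfty_nbhs R).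
Proof.
move=> s N [a [_ aN]]; exists (a - s); split; first exact: num_real.
by move=> t ast; apply: aN; rewrite -ltrBrDr.
Qed.

Lemma nonincreasing_cvg_ninfty g : {homo g : s t /~ s <= t} -> has_ubound (range g) ->
  g s @[s --> -oo] --> sup (range g).
Proof.
move=> g_ni g_ub; apply/cvgNy_compNP.
have range_compN : range (g \o -%R) = range g.
  by apply/seteqP; split=> [_ [s _ <-]|_ [s _ <-]];
    [exists (- s)|exists (- s); rewrite //= opprK].
rewrite -range_compN; apply: nondecreasing_cvgr; last by rewrite range_compN.
by move=> s t st; apply: g_ni; rewrite lerN2.
Qed.

Lemma nonincreasing_cvg_pinfty g : {homo g : s t /~ s <= t} -> has_lbound (range g) ->
  g s @[s --> +oo] --> inf (range g).
Proof.
move=> g_ni g_lb.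
have range_opp : range (\- g) = -%R @` range g by rewrite image_comp.
rewrite /inf -range_opp -[X in X s @[s --> _]]opprK.
apply: cvgN; apply: nondecreasing_cvgr; first by move=> s t st; rewrite lerN2; exact: g_ni.
by rewrite range_opp; exact/has_lb_ubN.
Qed.

Lemma frequently_eq_pinfty g (r : R) : continuous g ->
  (forall a, exists2 s, a < s & g s < r) -> ~ (\forall s \near +oo, g s < r) ->
  forall a, exists2 s, a < s & g s = r.
Proof.
move=> g_cont g_lt g_nlt a.
have [b ab gb] := g_lt a.
have [c bc rc] : exists2 c, b <= c & r <= g c.
  apply: contrapT => nc; apply: g_nlt; exists b; split; first exact: num_real.
  by move=> s /ltW bs; rewrite ltNge; apply/negP => rs; apply: nc; exists s.
have [||s + gs] := @IVT _ g b c r bc.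
- exact: continuous_subspaceT.
- by rewrite ge_min le_max (ltW gb) rc orbT.
by rewrite in_itv/= => /andP[bs _]; exists s => //; exact: lt_le_trans bs.
Qed.

End RealFunctionsAtInfinity.

Section OneSidedIncrements.
Context {R : realType} {V : normedModType R}.
Implicit Types (y d : R -> V).

Lemma is_derive_increments y (s : R) (d : V) :
  (forall e, 0 < e -> \forall t \near s, `|y t - y s - (t - s) *: d| <= e * `|t - s|) ->
  is_derive s 1 y d.
Proof.
move=> y_incr.
have y_quot : (h^-1 *: ((y \o shift s) (h *: 1) - y s)) @[h --> 0^'] --> d.
  apply/cvgrPdist_le => e e0.
  have /nbhs_ballP[r r0 ry] := y_incr e e0.
  exists r => //= h; rewrite /ball_/= sub0r normrN => hr h0.
  have yh : `|y (h + s) - y s - h *: d| <= e * `|h|.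
    have := ry (h + s); rewrite /ball/= opprD addrCA subrr addr0 normrN addrK.
    exact.
  rewrite [h *: 1]mulr1 -[d in d - _](scalerK h0) -scalerBr normrZ normfV.
  by rewrite ler_pdivrMl ?normr_gt0// -normrN opprB mulrC.
by apply: DeriveDef; [apply/cvg_ex; exists d|exact: cvg_lim].
Qed.

Lemma continuous_one_sided_lipschitz y (r C : R) : 0 < r ->
  (forall s t, s <= t <= s + r -> `|y t - y s| <= C * (t - s)) -> continuous y.
Proof.
move=> r0 yC s; apply/cvgrPdist_le => e e0.
have C0 : 0 < `|C| + 1 by rewrite ltr_wpDl.
have m0 : 0 < Num.min r (e / (`|C| + 1)) by rewrite lt_min r0 divr_gt0.
apply: filterS (nbhsx_ballx s _ m0) => t /ltW; rewrite le_min => /andP[str].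
rewrite ler_pdivlMr// => ste.
have Cste : C * `|s - t| <= e.
  apply: le_trans ste; rewrite mulrC ler_wpM2l//.
  by apply: le_trans (ler_norm _) _; rewrite lerDl.
have [st|/ltW ts] := leP s t.
  move: str Cste; rewrite distrC ger0_norm ?subr_ge0// => str Cste.
  rewrite distrC; apply: le_trans (yC _ _ _) Cste.
  by rewrite st/=; lra.
move: str Cste; rewrite ger0_norm ?subr_ge0// => str Cste.
apply: le_trans (yC _ _ _) Cste.
by rewrite ts/=; lra.
Qed.

Lemma is_derive_one_sided y d : continuous d ->
  (forall e, 0 < e -> exists2 r, 0 < r & forall s t, s <= t <= s + r ->
    `|y t - y s - (t - s) *: d s| <= e * (t - s)) ->
  forall s : R, is_derive s 1 y (d s).
Proof.
move=> d_cont y_incr s; apply: is_derive_increments => e e0.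
have e2 : 0 < e / 2 by rewrite divr_gt0.
have [r r0 ry] := y_incr _ e2.
near=> t.
have str : `|s - t| <= r by apply: ltW; near: t; exact: (nbhsx_ballx s).
have dst : `|d s - d t| <= e / 2 by near: t; exact: cvgr_dist_le (d_cont s) _ e2.
have [st|/ltW ts] := leP s t.
  move: str; rewrite distrC ger0_norm ?subr_ge0// => str.
  apply: le_trans (ry _ _ _) _; first by rewrite st/=; lra.
  by rewrite ler_wpM2r ?subr_ge0//; lra.
move: str; rewrite (distrC t) ger0_norm ?subr_ge0// => str.
have -> : y t - y s - (t - s) *: d s =
   (s - t) *: (d s - d t) - (y s - y t - (s - t) *: d t).
  rewrite scalerBr -[t - s]opprB scaleNr opprK.
  by rewrite [in RHS]opprB addrA subrK opprB addrC.
apply: le_trans (ler_normB _ _) _.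
rewrite normrZ (ger0_norm (_ : 0 <= s - t)) ?subr_ge0//.
have ryts : `|y s - y t - (s - t) *: d t| <= e / 2 * (s - t).
  by apply: ry; rewrite ts/=; lra.
have st0 : 0 <= s - t by rewrite subr_ge0.
have := ler_wpM2l st0 dst; lra.
Unshelve. all: by end_near. Qed.

End OneSidedIncrements.

Section GradientLikeSystems.
Context {R : realType} {V : normedModType R}.
Variables (G : V -> V) (E : V -> R) (K : set V) (rho : R -> R).
Implicit Types (z : R -> V) (d v x : V) (dl eta r s t : R).

Definition equilibria : set V := [set x | G x = 0].

(* No continuity is required, so jumps of size [dl] are allowed. The modulus [rho]
   is shared by all pseudo-orbits of a family, which makes the definition stable
   under pointwise limits; for [dl = 0] they are trajectories of [G]. *)
Definition pseudo_orbit dl z : Prop :=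
  [/\ forall s, K (z s), forall s t, s <= t -> E (z t) <= E (z s) + dl
    & forall e s t, 0 < e -> s <= t <= s + rho e ->
        `|z t - z s - (t - s) *: G (z s)| <= e * (t - s) + dl].

Definition heteroclinic z d d' : Prop :=
  [/\ forall s : R, is_derive s 1 z (G (z s)),
      z s @[s --> -oo] --> d & z s @[s --> +oo] --> d'].

Definition heteroclinic_chain d v : Prop :=
  exists (m : nat) (us : nat -> V) (vs : nat -> R -> V),
    [/\ us 0%N = d, us m = v, forall i, (i <= m)%N -> equilibria (us i),
      forall i, (i < m)%N -> E (us i.+1) < E (us i)
    & forall i, (1 <= i <= m)%N -> heteroclinic (vs i) (us i.-1) (us i)].

Definition connects d v : Prop := forall dl, 0 < dl ->
  exists z, [/\ pseudo_orbit dl z, exists a, forall s, s <= a -> z s = d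
    & exists b, forall s, b <= s -> z s = v].

Hypotheses (K_compact : compact K) (G_cont : continuous G) (E_cont : continuous E).
Hypothesis rho_gt0 : forall e, 0 < e -> 0 < rho e.
Hypothesis strict_lyapunov : forall z, (forall s : R, is_derive s 1 z (G (z s))) ->
  (forall s, E (z s) = E (z 0)) -> forall s, equilibria (z s).

Lemma pseudo_orbit_shift dl z (a : R) :
  pseudo_orbit dl z -> pseudo_orbit dl (fun s => z (a + s)).
Proof.
move=> [zK zE zG]; split=> [s|s t st|e s t e0 st]; first exact: zK.
- by apply: zE; rewrite lerD2l.
- have -> : t - s = a + t - (a + s) by ring.
  by apply: zG => //; rewrite lerD2l -addrA lerD2l.
Qed.

Lemma pseudo_orbit_le dl dl' z : dl <= dl' -> pseudo_orbit dl z -> pseudo_orbit dl' z.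
Proof.
move=> dl_le [zK zE zG]; split=> // [s t /zE|e s t e0 /(zG e s t e0)] /le_trans -> //.
  by rewrite lerD2l.
by rewrite lerD2l.
Qed.

Lemma equilibria_closed : closed equilibria.
Proof.
rewrite (_ : equilibria = G @^-1` [set 0]) //; apply: preimage_closed => //.
exact/accessible_closed_set1/hausdorff_accessible/norm_hausdorff.
Qed.

Lemma pseudo_orbit_ultralimit (I : Type) (U : set_system I) (dl : I -> R) (z : I -> R -> V) :
  UltraFilter U -> dl i @[i --> U] --> (0 : R) -> (forall i, pseudo_orbit (dl i) (z i)) ->
  exists2 y, forall s, z i s @[i --> U] --> y s & pseudo_orbit 0 y.
Proof.
move=> U_ultra dl0 z_po.
have /choice[y yP] : forall s, exists l, K l /\ z i s @[i --> U] --> l.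
  move=> s; have [i|l Kl zl] := ultra_cvg_compact U_ultra K_compact (h := z ^~ s).
    by have [zK _ _] := z_po i; exact: zK.
  by exists l.
have zy s : z i s @[i --> U] --> y s by have [] := yP s.
exists y => //; split=> [s|s t st|e s t e0 st]; first by have [] := yP s.
- apply: (@ler_cvg_filter _ _ U (fun i => E (z i t)) (fun i => E (z i s) + dl i)).
  + exact: (cvg_comp _ _ (zy t) (@E_cont _)).
  + by apply: cvgD => //; exact: (cvg_comp _ _ (zy s) (@E_cont _)).
  + by move=> i; have [_ zE _] := z_po i; exact: zE.
- apply: (@ler_cvg_filter _ _ U (fun i => `|z i t - z i s - (t - s) *: G (z i s)|)
      (fun i => e * (t - s) + dl i)).
  + apply: cvg_norm; apply: cvgB; first exact: cvgB.
    by apply: cvgZl_tmp; exact: (cvg_comp _ _ (zy s) (@G_cont _)).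
  + by apply: cvgD => //; exact: cvg_cst.
  + by move=> i; have [_ _ zG] := z_po i; exact: zG.
Qed.

Section Orbit.
Variable z : R -> V.
Hypothesis z_orbit : pseudo_orbit 0 z.

Lemma orbit_continuous : continuous z.
Proof.
have [zK _ zG] := z_orbit.
have [C C0 GC] := continuous_bounded_on_compact K_compact (continuous_subspaceT G_cont).
apply: (@continuous_one_sided_lipschitz _ _ _ (rho 1) (1 + C)); first exact: rho_gt0.
move=> s t /[dup] /andP[+ _] /(zG _ _ _ ltr01); rewrite -subr_ge0 addr0 => st0 zst.
rewrite -(subrK ((t - s) *: G (z s)) (z t - z s)) mulrDl.
apply: le_trans (ler_normD _ _) (lerD zst _).
by rewrite normrZ ger0_norm// mulrC ler_wpM2r// GC.
Qed.

Lemma is_derive_orbit s : is_derive s 1 z (G (z s)).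
Proof.
have [_ _ zG] := z_orbit.
apply: (@is_derive_one_sided _ _ z (G \o z)) => [{}s|e e0].
  by apply: continuous_comp; [exact: orbit_continuous|exact: G_cont].
exists (rho e) => [|{}s t st]; first exact: rho_gt0.
by have := zG e s t e0 st; rewrite addr0.
Qed.

Lemma orbit_energy_nonincreasing : {homo E \o z : s t /~ s <= t}.
Proof. by move=> s t st; have [_ + _] := z_orbit => /(_ _ _ st); rewrite addr0. Qed.

Lemma orbit_energy_bounded : has_lbound (range (E \o z)) /\ has_ubound (range (E \o z)).
Proof.
have [zK _ _] := z_orbit.
have [C _ EC] := @continuous_bounded_on_compact _ _ R^o _ _ K_compact
  (continuous_subspaceT E_cont).
by split; [exists (- C)|exists C] => _ [s _ <-]; have := EC _ (zK s);
  rewrite ler_norml => /andP[].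
Qed.

Lemma orbit_energy_cvg_pinfty : E (z s) @[s --> +oo] --> inf (range (E \o z)).
Proof.
by apply: nonincreasing_cvg_pinfty orbit_energy_nonincreasing _; case: orbit_energy_bounded.
Qed.

Lemma orbit_energy_cvg_ninfty : E (z s) @[s --> -oo] --> sup (range (E \o z)).
Proof.
by apply: nonincreasing_cvg_ninfty orbit_energy_nonincreasing _; case: orbit_energy_bounded.
Qed.

Lemma orbit_energy_itv s : inf (range (E \o z)) <= E (z s) <= sup (range (E \o z)).
Proof.
have [E_lb E_ub] := orbit_energy_bounded.
by rewrite (ge_inf E_lb) ?(ub_le_sup E_ub)//; exists s.
Qed.

End Orbit.

Section OrbitLimits.
Variable z : R -> V.
Hypothesis z_orbit : pseudo_orbit 0 z.

Lemma orbit_ultra_cvg (U : set_system R) : UltraFilter U ->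
  exists2 x, K x & z s @[s --> U] --> x.
Proof. by move=> UU; apply: ultra_cvg_compact => //; have [] := z_orbit. Qed.

(* LaSalle: a limit of translates of the orbit is an orbit of constant energy. *)
Lemma orbit_limit_equilibrium (F U : set_system R) (L : R) x :
  translation_invariant F -> E (z s) @[s --> F] --> L -> UltraFilter U -> F `<=` U ->
  z s @[s --> U] --> x -> equilibria x.
Proof.
move=> F_inv EL U_ultra FU zx.
have [y zy y_orbit] := pseudo_orbit_ultralimit U_ultra (cvg_cst 0)
  (fun tau => pseudo_orbit_shift tau z_orbit).
have y0 : y 0 = x.
  apply: (cvg_unique (@norm_hausdorff _ _) (zy 0)).
  by rewrite (_ : (fun tau => z (tau + 0)) = z)//; apply/funext => tau; rewrite addr0.
have Ey s : E (y s) = L.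
  have Ezy : E (z (tau + s)) @[tau --> U] --> E (y s).
    exact: (cvg_comp _ _ (zy s) (@E_cont _)).
  apply: (cvg_unique (@norm_hausdorff _ R^o) Ezy) => N /EL FN.
  by apply: FU; exact: (F_inv s _ FN).
rewrite -y0; apply: strict_lyapunov => [t|t]; last by rewrite !Ey.
exact: is_derive_orbit.
Qed.

Lemma orbit_alpha_limit d r : (forall x, `|x - d| <= r -> equilibria x -> x = d) ->
  (forall s, s < 0 -> `|z s - d| <= r) -> z s @[s --> -oo] --> d.
Proof.
move=> d_isolated z_near; apply: cvg_ultra => U U_ultra ooU.
have [x Kx zx] := orbit_ultra_cvg U_ultra.
have x_eq : equilibria x.
  apply: (orbit_limit_equilibrium _ (orbit_energy_cvg_ninfty z_orbit) U_ultra ooU zx).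
  exact: translation_invariant_ninfty.
rewrite -(d_isolated x) //.
have dist_cvg : `|z s - d| @[s --> U] --> `|x - d|.
  by apply: cvg_norm; apply: cvgB => //; exact: cvg_cst.
apply: (cvgr_to_le dist_cvg); apply: ooU; exists 0; split; first exact: num_real.
exact: z_near.
Qed.

Hypothesis equilibria_isolated : equilibria `<=` isolated equilibria.

(* An orbit returning to [d] and leaving it infinitely often would cross a small
   sphere around [d] infinitely often, hence accumulate at an equilibrium there. *)
Lemma orbit_omega_limit : exists d, [/\ K d, equilibria d & z s @[s --> +oo] --> d].
Proof.
have limit_eq (U : set_system R) x : UltraFilter U -> pinfty_nbhs R `<=` U ->
    z s @[s --> U] --> x -> equilibria x.
  move=> U_ultra ooU.
  apply: (orbit_limit_equilibrium _ (orbit_energy_cvg_pinfty z_orbit) U_ultra ooU).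
  exact: translation_invariant_pinfty.
have [U [U_ultra ooU]] := ultraFilterLemma (@proper_pinfty_nbhs R).
have [d Kd zd] := orbit_ultra_cvg U_ultra.
have d_eq := limit_eq _ _ U_ultra ooU zd.
have [r r0 d_isolated] := isolated_norm (equilibria_isolated d_eq).
exists d; split => //; apply/cvgrPdist_lt => e e0.
pose q := Num.min r e; have q0 : 0 < q by rewrite lt_min r0.
suff : \forall s \near +oo, `|d - z s| < q.
  by apply: filterS => s; rewrite lt_min => /andP[].
apply: contrapT => z_leaves.
have z_sphere : forall a, exists2 s, a < s & `|d - z s| = q.
  apply: frequently_eq_pinfty z_leaves => [s|a].
    by apply: cvg_norm; apply: cvgB; [exact: cvg_cst|exact: orbit_continuous].
  have Ua : U [set s | a < s] by apply: ooU; apply: nbhs_pinfty_gt; exact: num_real.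
  by have [s [/= ? ?]] := filter_ex (filterI Ua (cvgr_dist_lt _ _ zd _ q0)); exists s.
have W_proper : ProperFilter (within [set s | `|d - z s| = q] (pinfty_nbhs R)).
  apply: Build_ProperFilter => -[a [_ aW]].
  by have [s /aW] := z_sphere a; exact.
have [U' [U'_ultra WU']] := ultraFilterLemma W_proper.
have ooU' : pinfty_nbhs R `<=` U' by move=> N ooN; apply: WU'; exact: filterS ooN.
have [x _ zx] := orbit_ultra_cvg U'_ultra.
have x_sphere : q = `|d - x|.
  apply: (cvg_unique (@norm_hausdorff _ R^o) (F := `|d - z s| @[s --> U'])).
    apply: cvg_near_cst; apply: WU'; exact: withinT.
  by apply: cvg_norm; apply: cvgB => //; exact: cvg_cst.
have xd : x = d.
  apply: d_isolated (limit_eq _ _ U'_ultra ooU' zx).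
  by rewrite distrC -x_sphere ge_min lexx.
by move: q0; rewrite x_sphere xd subrr normr0 ltxx.
Qed.

End OrbitLimits.

Lemma orbit_energy_lt z d d' : pseudo_orbit 0 z -> ~ equilibria (z 0) ->
  z s @[s --> -oo] --> d -> z s @[s --> +oo] --> d' -> E d' < E d.
Proof.
move=> z_orbit z0_neq zd zd'.
have E_cvg (F : set_system R) x : Filter F -> z s @[s --> F] --> x ->
    E (z s) @[s --> F] --> E x.
  by move=> FF zx; exact: (cvg_comp _ _ zx (@E_cont _)).
have -> : E d = sup (range (E \o z)).
  exact: (cvg_unique (@norm_hausdorff _ R^o) (E_cvg _ _ _ zd) (orbit_energy_cvg_ninfty z_orbit)).
have -> : E d' = inf (range (E \o z)).
  exact: (cvg_unique (@norm_hausdorff _ R^o) (E_cvg _ _ _ zd') (orbit_energy_cvg_pinfty z_orbit)).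
have E_itv := orbit_energy_itv z_orbit.
have /andP[inf_le le_sup] := E_itv 0.
rewrite lt_neqAle (le_trans inf_le le_sup) andbT; apply/eqP => inf_sup.
have E_const s : E (z s) = sup (range (E \o z)).
  by apply/eqP; rewrite eq_le; have := E_itv s; rewrite inf_sup andbC.
apply: z0_neq; apply: strict_lyapunov => [s|s]; last by rewrite !E_const.
exact: is_derive_orbit.
Qed.

Hypothesis equilibria_isolated : equilibria `<=` isolated equilibria.
Hypothesis rho_le1 : forall e, rho e <= 1.

(* Pseudo-orbits may jump, so one can start at rest at [d] and jump at time [a]. *)
Lemma pseudo_orbit_splice dl eta z d (a : R) :
  pseudo_orbit dl z -> 0 <= dl -> K d -> equilibria d ->
  `|z a - d| <= eta -> `|G (z a)| <= eta -> E (z a) <= E d + eta ->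
  pseudo_orbit (dl + 2 * eta) (fun s => if s < a then d else z s).
Proof.
move=> [zK zE zG] dl0 Kd d_eq zad Gza Eza.
have eta0 : 0 <= eta := le_trans (normr_ge0 _) zad.
split=> [s|s t st|e s t e0 /andP[st ts]]; first by case: ifP.
- case: (ltP t a) => ta; case: (ltP s a) => sa.
  + by rewrite lerDl; lra.
  + by have := le_lt_trans (le_trans sa st) ta; rewrite ltxx.
  + by have := zE a t ta; lra.
  + by have := zE s t st; lra.
- have st0 : 0 <= t - s by rewrite subr_ge0.
  have est0 : 0 <= e * (t - s) by rewrite mulr_ge0// ltW.
  case: (ltP t a) => ta; case: (ltP s a) => sa.
  + by rewrite d_eq scaler0 !subrr normr0; lra.
  + by have := le_lt_trans (le_trans sa st) ta; rewrite ltxx.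
  + have ta0 : 0 <= t - a by rewrite subr_ge0.
    have ta_le1 : t - a <= 1 by have := rho_le1 e; lra.
    have zat : `|z t - z a - (t - a) *: G (z a)| <= e * (t - a) + dl.
      by apply: zG => //; rewrite ta/=; lra.
    have Gta : `|(t - a) *: G (z a)| <= eta.
      by rewrite normrZ ger0_norm//; apply: le_trans (ler_piMl _ ta_le1) Gza.
    have eta_le : e * (t - a) <= e * (t - s) by rewrite ler_wpM2l//; lra.
    rewrite d_eq scaler0 subr0.
    have -> : z t - d = z t - z a - (t - a) *: G (z a) + (t - a) *: G (z a) + (z a - d).
      by rewrite subrK addrA subrK.
    apply: le_trans (ler_normD _ _) _.
    have := ler_normD (z t - z a - (t - a) *: G (z a)) ((t - a) *: G (z a)).
    by lra.
  + by have := zG e s t e0; rewrite st ts => /(_ isT); lra.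
Qed.

(* Time 0 is the exit from the ball of radius [r] around [d], up to [dl]. *)
Lemma connects_exit d v r dl : connects d v -> 0 < r -> r <= `|v - d| -> 0 < dl ->
  exists z, [/\ pseudo_orbit dl z, r <= `|z 0 - d|,
    forall s, s <= - dl -> `|z s - d| <= r & exists b, forall s, b <= s -> z s = v].
Proof.
move=> dv r0 r_le dl0; have [z [z_po [a za] [b zb]]] := dv dl dl0.
pose outside := [set s | r <= `|z s - d|].
have b_outside : outside b by rewrite /outside/= zb.
have a_lb : lbound outside a.
  move=> s s_out; rewrite leNgt; apply/negP => /ltW /za zsd.
  by move: s_out; rewrite /outside/= zsd subrr normr0 leNgt r0.
have outside_inf : has_inf outside by split; [exists b|exists a].
have [s0 s0_out s0_inf] := inf_adherent dl0 outside_inf.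
exists (fun s => z (s0 + s)); split; first exact: pseudo_orbit_shift.
- by rewrite addr0.
- move=> s sdl; rewrite leNgt; apply/negP => /ltW s_out.
  by have := ge_inf outside_inf.2 (s_out : outside (s0 + s)); lra.
- by exists (b - s0) => s sb; apply: zb; lra.
Qed.

Lemma connects_exit_orbit d v r : connects d v -> 0 < r -> r <= `|v - d| ->
  exists y, [/\ pseudo_orbit 0 y, `|y 0 - d| = r, forall s, s < 0 -> `|y s - d| <= r
    & forall s dl N, 0 < dl -> nbhs (y s) N -> exists z,
        [/\ pseudo_orbit dl z, N (z s) & exists b, forall t, b <= t -> z t = v]].
Proof.
move=> dv r0 r_le.
have dl_gt0 (k : nat) : 0 < k.+1%:R^-1 :> R by rewrite invr_gt0.
have /choice[z zP] := fun k => connects_exit dv r0 r_le (dl_gt0 k).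
have [U [U_ultra ooU]] := ultraFilterLemma (@eventually_filter).
have dl_cvg : k.+1%:R^-1 @[k --> U] --> (0 : R).
  by move=> N /(@cvg_harmonic R) ooN; exact: ooU.
have z_po k : pseudo_orbit k.+1%:R^-1 (z k) by have [] := zP k.
have [y zy y_orbit] := pseudo_orbit_ultralimit U_ultra dl_cvg z_po.
have dist_cvg s : `|z k s - d| @[k --> U] --> `|y s - d|.
  by apply: cvg_norm; apply: cvgB; [exact: zy|exact: cvg_cst].
have y_past s : s < 0 -> `|y s - d| <= r.
  rewrite -oppr_gt0 => s0; apply: (cvgr_to_le (dist_cvg s)).
  have Us : U [set k : nat | k.+1%:R^-1 <= - s] by apply: (cvgr_le (0 : R)).
  apply: filterS Us => k /= dl_le.
  by have [_ _ + _] := zP k; apply; rewrite lerNr.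
exists y; split => //.
- apply/eqP; rewrite eq_le; apply/andP; split.
    have y_left : `|y s - d| @[s --> 0^'-] --> `|y 0 - d|.
      apply: cvg_norm; apply: cvgB; last exact: cvg_cst.
      exact/cvg_at_left_filter/orbit_continuous.
    by apply: (cvgr_to_le y_left); near=> s; exact: y_past.
  by apply: (cvgr_to_ge (dist_cvg 0)); apply: nearW => k; have [] := zP k.
- move=> s dl N dl0 Nys.
  have Udl : U [set k : nat | k.+1%:R^-1 <= dl] by apply: (cvgr_le (0 : R)).
  have UN : U [set k | N (z k s)] by exact: zy.
  have [k [/= dl_le Nz]] := filter_ex (filterI Udl UN).
  by have [_ _ _ zv] := zP k; exists (z k); split => //; exact: pseudo_orbit_le (z_po k).
Unshelve. all: by end_near. Qed.

Lemma connects_restart d v (y : R -> V) : K d -> equilibria d -> y s @[s --> +oo] --> d ->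
  (forall s dl N, 0 < dl -> nbhs (y s) N -> exists z,
     [/\ pseudo_orbit dl z, N (z s) & exists b, forall t, b <= t -> z t = v]) ->
  connects d v.
Proof.
move=> Kd d_eq yd y_approx dl dl0; have eta0 : 0 < dl / 4 by lra.
pose N := [set x | [/\ `|x - d| <= dl / 4, `|G x| <= dl / 4 & E x <= E d + dl / 4]].
have Nd : \forall x \near d, N x.
  have G_near : \forall x \near d, `|G x| <= dl / 4.
    by apply: cvgr0_norm_le eta0; rewrite -d_eq; exact: G_cont.
  have E_near : \forall x \near d, `|E x - E d| <= dl / 4.
    by apply: cvgr_distC_le eta0; exact: E_cont.
  near=> x; split; last 1 first.
  - rewrite -lerBlDl; apply: le_trans (ler_norm _) _; near: x; exact: E_near.
  - by near: x; apply: cvgr_distC_le eta0; exact: cvg_id.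
  - by near: x; exact: G_near.
have N_eventually : \forall s \near +oo, nbhs (y s) N by exact: yd (nbhs_interior Nd).
have [a Na] := filter_ex N_eventually.
have dl2_gt0 : 0 < dl / 2 by lra.
have [z [z_po [zad Gza Eza] [b zb]]] := y_approx a (dl / 2) N dl2_gt0 Na.
exists (fun s => if s < a then d else z s); split.
- have := pseudo_orbit_splice z_po (ltW dl2_gt0) Kd d_eq zad Gza Eza.
  by apply: pseudo_orbit_le; lra.
- by exists (a - 1) => s sa; rewrite ifT//; lra.
- exists (Num.max b a) => s; rewrite ge_max => /andP[bs as_].
  by rewrite ltNge as_/=; exact: zb.
Unshelve. all: by end_near. Qed.

Lemma connects_step d v : equilibria d -> d <> v -> connects d v ->
  exists d' y, [/\ K d', equilibria d', E d' < E d, heteroclinic y d d' & connects d' v].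
Proof.
move=> d_eq d_neq_v dv.
have [q q0 d_isolated] := isolated_norm (equilibria_isolated d_eq).
pose r := Num.min q `|v - d|.
have r0 : 0 < r by rewrite lt_min q0 normr_gt0 subr_eq0; apply/eqP => /esym.
have {}d_isolated x : `|x - d| <= r -> equilibria x -> x = d.
  by rewrite le_min => /andP[+ _]; exact: d_isolated.
have r_le : r <= `|v - d| by rewrite ge_min lexx orbT.
have [y [y_orbit y0 y_past y_approx]] := connects_exit_orbit dv r0 r_le.
have yd := orbit_alpha_limit y_orbit d_isolated y_past.
have [d' [Kd' d'_eq yd']] := orbit_omega_limit y_orbit equilibria_isolated.
have y0_neq : ~ equilibria (y 0).
  move=> /(d_isolated _); rewrite y0 lexx => /(_ isT) y0d.
  by move: r0; rewrite -y0 y0d subrr normr0 ltxx.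
exists d', y; split => //.
- exact: orbit_energy_lt y_orbit y0_neq yd yd'.
- by split => // s; exact: is_derive_orbit.
- exact: connects_restart yd' y_approx.
Qed.

Lemma heteroclinic_chain_cons d d' v (y : R -> V) :
  equilibria d -> E d' < E d -> heteroclinic y d d' ->
  heteroclinic_chain d' v -> heteroclinic_chain d v.
Proof.
move=> d_eq E_lt y_het [m [us [vs [us0 usm us_eq us_lt vs_het]]]].
exists m.+1, (fun i => if i is j.+1 then us j else d),
  (fun i => if i is j.+2 then vs j.+1 else y).
split => //.
- by case.
- by case=> [|i] im /=; [rewrite us0|exact: us_lt].
- by case=> [|[|i]]//= im; [rewrite us0|exact: (vs_het i.+1)].
Qed.

Lemma connects_chain d v : equilibria d -> connects d v -> heteroclinic_chain d v.
Proof.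
move=> d_eq dv; apply: contrapT => no_chain.
pose stuck x := [/\ connects x v, equilibria x, K x & ~ heteroclinic_chain x v].
have stuck_d : stuck d.
  split => //; have [z [[zK _ _] [a za] _]] := dv 1 ltr01.
  by rewrite -(za a).
have stuck_step x : exists x', stuck x -> stuck x' /\ E x' < E x.
  have [[xv x_eq Kx nx]|] := pselect (stuck x); last by exists x.
  have x_neq_v : x <> v.
    move=> xv'; apply: nx; exists 0%N, (fun=> x), (fun=> cst x).
    by split => //; case.
  have [x' [y [Kx' x'_eq E_lt y_het x'v]]] := connects_step x_eq x_neq_v xv.
  exists x' => _; split => //; split => // x'_chain; apply: nx.
  exact: heteroclinic_chain_cons y_het x'_chain.
have [next nextP] := choice stuck_step.
pose x k := iter k next d.
have stuck_x k : stuck (x k) by elim: k => // k /nextP[].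
have E_lt i j : (i < j)%N -> E (x j) < E (x i).
  apply: (@homo_ltn _ (E \o x) (fun p q => q < p)) => [p q s pq qs|k]; first exact: lt_trans pq.
  by have [] := nextP _ (stuck_x k).
have Kx k : K (x k) by have [] := stuck_x k.
have x_eq k : equilibria (x k) by have [] := stuck_x k.
have [i [j [/E_lt]]] :=
  isolated_compact_repeat K_compact equilibria_closed equilibria_isolated Kx x_eq.
by move=> /[swap] ->; rewrite ltxx.
Qed.

End GradientLikeSystems.

Section PerturbedTrajectories.
Context {R : realType} {V : normedModType R}.
Variables (G : V -> V) (E : V -> R) (K : set V).
Implicit Types (z : R -> V) (d e s t : R).

(* An integral-free form of [|z t - z s - int_s^t G (z r) dr| <= d]: the mean value
   inequality for trajectories of [G], up to an error [d]. *)
Definition mean_value_inequality_upto d z : Prop :=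
  forall s t (c : V) e, s <= t <= s + 1 ->
    (forall r, s <= r <= t -> `|G (z r) - c| <= e) ->
    `|z t - z s - (t - s) *: c| <= e * (t - s) + d.

Hypotheses (K_compact : compact K) (G_cont : continuous G).

Lemma perturbed_trajectory_pseudo_orbit : exists rho : R -> R,
  [/\ forall e, 0 < e -> 0 < rho e, forall e, rho e <= 1
    & forall dl, 0 < dl -> exists2 d, 0 < d & forall z, (forall s, K (z s)) ->
        (forall s t, s <= t -> E (z t) <= E (z s) + dl) ->
        mean_value_inequality_upto d z -> pseudo_orbit G E K rho dl z].
Proof.
have G_contK : {within K, continuous G} := continuous_subspaceT G_cont.
have [C C0 GC] := continuous_bounded_on_compact K_compact G_contK.
have /choice[om omP] : forall e, exists r, 0 < e -> 0 < r /\
    forall x y, K x -> K y -> `|x - y| <= r -> `|G x - G y| <= e.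
  move=> e; have [e0|e0] := ltP 0 e; last by exists 0.
  by have [r r0 rG] := compact_uniform_continuous K_compact G_contK e0; exists r.
have den_gt0 : 0 < 2 * (C + 1) by rewrite mulr_gt0// ltr_wpDl.
pose rho e := Num.min 1 (om e / (2 * (C + 1))).
have rho_gt0 e : 0 < e -> 0 < rho e.
  by move=> /omP[om_gt0 _]; rewrite lt_min ltr01 divr_gt0.
have rho_le1 e : rho e <= 1 by rewrite ge_min lexx.
exists rho; split => // dl dl0.
have dl2_gt0 : 0 < dl / 2 by rewrite divr_gt0.
have [om_gt0 omG] := omP _ dl2_gt0.
exists (Num.min (dl / 2) (om (dl / 2) / 2)); first by rewrite lt_min dl2_gt0 divr_gt0.
set d := Num.min _ _ => z zK zE zmvi.
have d_dl : d <= dl / 2 by rewrite ge_min lexx.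
have d_om : d <= om (dl / 2) / 2 by rewrite ge_min lexx orbT.
split => // e s t e0 /andP[st ts].
have [om_e_gt0 omGe] := omP e e0.
have rho_C : C * rho e <= om e / 2.
  have : rho e * (2 * (C + 1)) <= om e by rewrite -ler_pdivlMr// ge_min lexx orbT.
  by have := rho_gt0 e e0; lra.
have ts_le1 : t - s <= 1 by have := rho_le1 e; lra.
have z_close r : s <= r <= t -> `|z r - z s| <= om e / 2 + d.
  move=> /andP[sr rt].
  have := @zmvi s r 0 C; rewrite sr scaler0 subr0 => z_incr.
  apply: le_trans (z_incr _ _) _; first by rewrite /=; lra.
    by move=> q _; rewrite subr0 GC.
  rewrite lerD2r; apply: le_trans rho_C; rewrite ler_wpM2l//; lra.
have Gz_close r : s <= r <= t -> `|G (z r) - G (z s)| <= e + dl / 2.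
  move=> /z_close zrs; have [d_small|d_large] := leP d (om e / 2).
    by apply: le_trans (omGe _ _ (zK _) (zK _) _) _; lra.
  by apply: le_trans (omG _ _ (zK _) (zK _) _) _; lra.
apply: le_trans (zmvi s t (G (z s)) (e + dl / 2) _ Gz_close) _.
  by rewrite st/=; lra.
have := ler_wpM2l (ltW dl2_gt0) ts_le1; lra.
Qed.

End PerturbedTrajectories.

Section MatrixTopology.
Context {R : realType}.

Lemma mx_norm_le m n (x : 'M[R]_(m, n)) (c : R) :
  0 <= c -> (forall i j, `|x i j| <= c) -> `|x| <= c.
Proof.
move=> c0 xc; rewrite [leLHS]/Num.norm/= mx_normrE.
by apply/bigmax_leP; split => // -[i j] _; exact: xc.
Qed.

Lemma entry_le_mx_norm m n (x : 'M[R]_(m, n)) i j : `|x i j| <= `|x|.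
Proof.
rewrite [leRHS]/Num.norm/= mx_normrE; apply/bigmax_geP; right => /=.
by exists (i, j).
Qed.

Lemma mulmx_norm_le m n p (A : 'M[R]_(m, n)) (x : 'M[R]_(n, p)) :
  `|A *m x| <= n%:R * `|A| * `|x|.
Proof.
apply: mx_norm_le; first by rewrite !mulr_ge0.
move=> i j; rewrite mxE; apply: le_trans (ler_norm_sum _ _ _) _.
rewrite -mulrA mulr_natl -[X in _ *+ X]card_ord -sumr_const.
by apply: ler_sum => k _; rewrite normrM; apply: ler_pM => //; exact: entry_le_mx_norm.
Qed.

Lemma cvg_mx (I : Type) (F : set_system I) m n
    (h : I -> 'M[R]_(m, n)) (l : 'M[R]_(m, n)) :
  Filter F -> (forall i j, h k i j @[k --> F] --> (l i j : R)) ->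
  h k @[k --> F] --> l.
Proof.
move=> F_filter hl; apply/cvgrPdist_le => e e0.
have entries_near : \forall k \near F, forall i j, `|l i j - h k i j| <= e.
  apply: filter_forall => i; apply: filter_forall => j.
  exact: cvgr_dist_le (hl i j) _ e0.
apply: filterS entries_near => k hk; apply: mx_norm_le; first exact: ltW.
by move=> i j; rewrite !mxE; exact: hk.
Qed.

Lemma cvg_entry (I : Type) (F : set_system I) m n
    (h : I -> 'M[R]_(m, n)) (l : 'M[R]_(m, n)) i j :
  h k @[k --> F] --> l -> h k i j @[k --> F] --> (l i j : R).
Proof. by move=> hl; apply: (cvg_comp h (fun M => M i j) hl); exact: coord_continuous. Qed.

Lemma mulmx_continuous m n p (A : 'M[R]_(m, n)) :
  continuous (fun x : 'M[R]_(n, p) => A *m x).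
Proof.
move=> x; apply: (cvg_mx (nbhs_filter x)) => i j; rewrite [X in _ --> X]mxE.
under eq_fun do rewrite mxE; apply: cvg_big; first exact: add_continuous.
by move=> k _; apply: cvgMl_tmp; exact: coord_continuous.
Qed.

Lemma trmx_continuous m n : continuous (fun x : 'M[R]_(m, n) => x^T).
Proof.
move=> x; apply: (cvg_mx (nbhs_filter x)) => i j; rewrite [X in _ --> X]mxE.
by under eq_fun do rewrite mxE; exact: coord_continuous.
Qed.

Lemma col_ball_compact n (M : R) : compact [set x : 'cV[R]_n | `|x| <= M].
Proof.
have normT m p (x : 'M[R]_(m, p)) : `|x^T| = `|x|.
  have normT_le q r (y : 'M[R]_(q, r)) : `|y^T| <= `|y|.
    by apply: mx_norm_le => // i j; rewrite mxE; exact: entry_le_mx_norm.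
  by apply/eqP; rewrite eq_le normT_le -[x in `|x| <= _]trmxK normT_le.
have row_compact : compact [set x : 'rV[R]_n | `|x| <= M].
  apply: bounded_closed_compact.
    by exists M; split; [exact: num_real|move=> c Mc x /= /le_trans; apply; exact: ltW].
  rewrite (_ : [set x | _] = Num.norm @^-1` [set y | y <= M]) //.
  by apply: preimage_closed; [move=> x _; exact: norm_continuous|exact: closed_le].
rewrite (_ : [set x : 'cV_n | _] = trmx @` [set x : 'rV[R]_n | `|x| <= M]).
  by apply: continuous_compact row_compact; exact/continuous_subspaceT/trmx_continuous.
apply/seteqP; split => [x xM|_ [x xM <-]]; last by rewrite /= normT.
by exists x^T; rewrite ?trmxK//= normT.
Qed.

End MatrixTopology.

Section QuadraticForms.
Context {R : realType} {n : nat}.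
Local Notation X := 'cV[R]_n.+1.
Implicit Types (x y z : X) (Q : 'M[R]_n.+1) (c : R).

Lemma dotC x y : dot x y = dot y x.
Proof. by apply: eq_bigr => i _; rewrite mulrC. Qed.

Lemma dotDl x y z : dot (x + y) z = dot x z + dot y z.
Proof. by rewrite -big_split; apply: eq_bigr => i _; rewrite !mxE mulrDl. Qed.

Lemma dotZl c x y : dot (c *: x) y = c * dot x y.
Proof. by rewrite mulr_sumr; apply: eq_bigr => i _; rewrite !mxE mulrA. Qed.

Lemma dotNl x y : dot (- x) y = - dot x y.
Proof. by rewrite -scaleN1r dotZl mulN1r. Qed.

Lemma dotDr x y z : dot x (y + z) = dot x y + dot x z.
Proof. by rewrite dotC dotDl !(dotC x). Qed.

Lemma dotZr c x y : dot x (c *: y) = c * dot x y.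
Proof. by rewrite dotC dotZl (dotC x). Qed.

Lemma dotNr x y : dot x (- y) = - dot x y.
Proof. by rewrite dotC dotNl (dotC x). Qed.

Lemma dot0l x : dot 0 x = 0.
Proof. by rewrite -[0](scale0r 0) dotZl mul0r. Qed.

Lemma dot0r x : dot x 0 = 0.
Proof. by rewrite dotC dot0l. Qed.

Lemma dot_delta x i : dot x (delta_mx i 0) = x i 0.
Proof.
rewrite /dot (bigD1 i)//= mxE !eqxx mulr1 big1 ?addr0// => j /negbTE ji.
by rewrite mxE ji mulr0.
Qed.

Lemma dot_mulmx Q x y : dot x (Q *m y) = dot (Q^T *m x) y.
Proof.
have dotE a b : dot a b = (a^T *m b) 0 0.
  by rewrite mxE; apply: eq_bigr => i _; rewrite mxE.
by rewrite !dotE trmx_mul trmxK mulmxA.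
Qed.

Lemma cvg_dot (I : Type) (F : set_system I) (h k : I -> X) x y :
  Filter F -> h i @[i --> F] --> x -> k i @[i --> F] --> y ->
  dot (h i) (k i) @[i --> F] --> dot x y.
Proof.
move=> FF hx ky; apply: cvg_big; first exact: add_continuous.
by move=> i _; apply: cvgM; exact: cvg_entry.
Qed.

Section Posdef.
Variable Q : 'M[R]_n.+1.
Hypothesis Q_spd : sym_posdef Q.

Lemma posdef_dotC x y : dot x (Q *m y) = dot y (Q *m x).
Proof. by rewrite dot_mulmx Q_spd.1 dotC. Qed.

Lemma posdef_ge0 x : 0 <= dot x (Q *m x).
Proof. by have [->|/Q_spd.2/ltW//] := eqVneq x 0; rewrite dot0l. Qed.

Lemma posdef_eq0 x : dot x (Q *m x) = 0 -> x = 0.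
Proof. by move=> x0; apply/eqP/negP => /negP /Q_spd.2; rewrite x0 ltxx. Qed.

Lemma posdef_cauchy_schwarz x y :
  dot x (Q *m y) ^+ 2 <= dot x (Q *m x) * dot y (Q *m y).
Proof.
have [->|y0] := eqVneq y 0; first by rewrite mulmx0 dot0r dot0l expr0n mulr0.
set a := dot x (Q *m x); set b := dot x (Q *m y); set c := dot y (Q *m y).
have c0 : 0 < c := Q_spd.2 y y0.
suff : 0 <= c * (a * c - b ^+ 2) by rewrite pmulr_rge0// subr_ge0.
have := posdef_ge0 (c *: x - b *: y).
rewrite mulmxBr -!scalemxAr !(dotDl, dotDr, dotNl, dotNr, dotZl, dotZr).
by rewrite (posdef_dotC y x) -/a -/b -/c; lra.
Qed.

Lemma posdef_unitmx : Q \in unitmx.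
Proof.
rewrite -row_free_unit -kermx_eq0; apply/eqP/row_matrixP => i.
rewrite row0; apply: trmx_inj; rewrite trmx0; apply: posdef_eq0.
have -> : Q *m (row i (kermx Q))^T = 0.
  rewrite -{1}Q_spd.1 -trmx_mul; have /sub_kermxP -> := row_sub i (kermx Q).
  by rewrite trmx0.
by rewrite dot0r.
Qed.

Lemma posdef_invmx : sym_posdef (invmx Q).
Proof.
split; first by rewrite trmx_inv Q_spd.1.
move=> x x0; have xE : x = Q *m (invmx Q *m x) by rewrite mulKVmx ?posdef_unitmx.
rewrite {1}xE dotC; apply: Q_spd.2; apply: contra_neq x0 => x0.
by rewrite xE x0 mulmx0.
Qed.

Lemma posdef_entry_le x i : x i 0 ^+ 2 <= invmx Q i i * dot x (Q *m x).
Proof.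
have := posdef_cauchy_schwarz x (invmx Q *m delta_mx i 0).
by rewrite mulKVmx ?posdef_unitmx// !dot_delta mulrC -colE mxE.
Qed.

Lemma posdef_norm_le x : `|x| ^+ 2 <= `|invmx Q| * dot x (Q *m x).
Proof.
have c0 : 0 <= `|invmx Q| * dot x (Q *m x) by rewrite mulr_ge0// posdef_ge0.
rewrite -[leRHS]sqr_sqrtr// ler_sqr ?nnegrE ?sqrtr_ge0//.
apply: mx_norm_le => [|i j]; first exact: sqrtr_ge0.
rewrite ord1 -sqrtr_sqr; apply: ler_wsqrtr.
apply: le_trans (posdef_entry_le _ _) _; rewrite ler_wpM2r ?posdef_ge0//.
exact: le_trans (ler_norm _) (entry_le_mx_norm _ _ _).
Qed.

Lemma sqr_qnorm x : qnorm Q x ^+ 2 = dot x (Q *m x).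
Proof. by rewrite sqr_sqrtr// posdef_ge0. Qed.

End Posdef.
End QuadraticForms.

Section Derivatives.
Context {R : realType}.

Lemma cvg_components (V W : topologicalType) (I : Type) (F : set_system I)
    (h : I -> V * W) (l : V * W) :
  h i @[i --> F] --> l -> (h i).1 @[i --> F] --> l.1 /\ (h i).2 @[i --> F] --> l.2.
Proof.
by move=> hl; split; [apply: (cvg_comp h fst hl); exact: cvg_fst|
  apply: (cvg_comp h snd hl); exact: cvg_snd].
Qed.

Lemma is_derive_pair (V W : normedModType R) (z : R -> V * W) (s : R) d :
  is_derive s 1 z d ->
  is_derive s 1 (fun t => (z t).1) d.1 /\ is_derive s 1 (fun t => (z t).2) d.2.
Proof.
move=> [z_derivable zE].
have z_quot : (h^-1 *: ((z \o shift s) (h *: 1) - z s)) @[h --> 0^'] --> d.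
  by rewrite -zE; exact: z_derivable.
have [fst_quot snd_quot] := cvg_components z_quot.
split; apply: DeriveDef; [|exact: cvg_lim fst_quot| |exact: cvg_lim snd_quot];
  by apply/cvg_ex; eexists; eassumption.
Qed.

Lemma is_derive_mxP m n (M : R -> 'M[R]_(m, n)) (s : R) (D : 'M[R]_(m, n)) :
  is_derive s 1 M D <->
  forall i j, is_derive s 1 (fun t => M t i j) (D i j).
Proof.
split=> [[M_derivable <-] i j|dM].
  have /derivable_mxP entry_derivable := M_derivable; rewrite derive_mx// mxE.
  exact/derivableP.
have M_derivable : derivable M s 1 by apply/derivable_mxP => i j; exact: ex_derive.
apply: DeriveDef => //; rewrite derive_mx//; apply/matrixP => i j.
by rewrite mxE; exact: derive_val.
Qed.

Lemma is_derive_fsum n (h : 'I_n -> R -> R) (s : R) (dh : 'I_n -> R) :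
  (forall i, is_derive s 1 (h i) (dh i)) ->
  is_derive s 1 (fun t => \sum_(i < n) h i t) (\sum_(i < n) dh i).
Proof.
move=> h_derive; have := is_derive_sum h_derive.
by congr (is_derive _ _ _ _); apply/funext => t; rewrite fct_sumE.
Qed.

Lemma is_derive_mulmx m n p (A : 'M[R]_(m, n)) (M : R -> 'M[R]_(n, p)) (s : R) D :
  is_derive s 1 M D -> is_derive s 1 (fun t => A *m M t) (A *m D).
Proof.
move=> /is_derive_mxP dM; apply/is_derive_mxP => i j; rewrite mxE.
under eq_fun do rewrite mxE.
exact: is_derive_fsum.
Qed.

Lemma is_derive_dot n (p q : R -> 'cV[R]_n.+1) (s : R) dp dq :
  is_derive s 1 p dp -> is_derive s 1 q dq ->
  is_derive s 1 (fun t => dot (p t) (q t)) (dot dp (q s) + dot (p s) dq).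
Proof.
move=> /is_derive_mxP p_derive /is_derive_mxP q_derive; rewrite -big_split/=.
apply: is_derive_fsum => k; have := is_deriveM (p_derive k 0) (q_derive k 0).
by move/is_derive_eq; apply; rewrite addrC; congr (_ + _); rewrite mulrC.
Qed.

Lemma derive_gradE n (f : 'cV[R]_n.+1 -> R) x v :
  differentiable f x -> 'D_v f x = dot (grad f x) v.
Proof.
move=> f_diff; rewrite deriveE// {1}[v]matrix_sum_delta linear_sum/=.
by apply: eq_bigr => i _; rewrite big_ord1 linearZ/= mxE deriveE// mulrC.
Qed.

Lemma is_derive_comp_grad n (f : 'cV[R]_n.+1 -> R) (w : R -> 'cV[R]_n.+1) (s : R) d :
  differentiable f (w s) -> is_derive s 1 w d ->
  is_derive s 1 (fun t => f (w t)) (dot (grad f (w s)) d).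
Proof.
move=> f_diff [w_derivable wE].
have w_diff : differentiable w s by exact/derivable1_diffP.
have fw_diff : differentiable (f \o w) s by exact: differentiable_comp.
apply: DeriveDef; first exact/derivable1_diffP.
rewrite deriveE// diff_comp//= (_ : 'd w s 1 = d); last by rewrite -wE deriveE.
by rewrite -deriveE// derive_gradE.
Qed.

Lemma is_derive_continuous (V : normedModType R) (f f' : R -> V) :
  (forall s : R, is_derive s 1 f (f' s)) -> continuous f.
Proof.
move=> f_derive s; apply: differentiable_continuous; apply/derivable1_diffP.
by have [] := f_derive s.
Qed.

Lemma is_derive_compM (f : R -> R) (k s d : R) :
  is_derive (k * s) 1 f d -> is_derive s 1 (fun t => f (k * t)) (k * d).
Proof.
move=> f_derive; have k_derive : is_derive s 1 (fun t : R => k * t) k.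
  by have := is_deriveZ k (is_derive_id s 1); move/is_derive_eq; apply; exact: mulr1.
by rewrite mulrC; exact: (@is_derive1_comp _ f (fun t => k * t)).
Qed.

End Derivatives.

Local Notation mu := lebesgue_measure.
Local Notation locL1 := (locally_integrable [set: _]).
Local Notation Int := (parameterized_integral mu).

Section LocallyIntegrable.
Context {R : realType}.
Implicit Types (f g h : R -> R) (s t r k : R).

Lemma locL1P f : locL1 f <-> measurable_fun [set: R] f /\
  forall K, compact K -> mu.-integrable K (EFin \o f).
Proof.
split=> [[mf _ f_fin]|[mf f_int]]; split=> //.
- move=> K Kc; apply/integrableP; split; last exact: f_fin.
  by apply/measurable_EFinP; exact: measurable_funS mf.
- exact: openT.
- by move=> K _ /f_int /integrableP[].
Qed.

Lemma locL1_itv f s t : locL1 f -> mu.-integrable `[s, t] (EFin \o f).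
Proof. by move=> /locL1P[_]; apply; exact: segment_compact. Qed.

Lemma locL1_le f g : measurable_fun [set: R] f ->
  (forall x, `|f x| <= g x) -> locL1 g -> locL1 f.
Proof.
move=> mf fg /locL1P[mg g_int]; apply/locL1P; split=> // K Kc.
apply: (le_integrable _ _ _ (g_int K Kc)); first exact: compact_measurable.
  by apply/measurable_EFinP; exact: measurable_funS mf.
by move=> x _; rewrite /= lee_fin; exact: le_trans (fg x) (ler_norm _).
Qed.

Lemma continuous_locL1 f : continuous f -> locL1 f.
Proof.
move=> f_cont; apply/locL1P; split=> [|K Kc]; first exact: continuous_measurable_fun.
by apply: continuous_compact_integrable => //; exact: continuous_subspaceT.
Qed.

Lemma locL1_cst k : locL1 (cst k : R -> R).
Proof. by apply: continuous_locL1 => x; exact: cvg_cst. Qed.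

Lemma locL1Z k f : locL1 f -> locL1 (fun x => k * f x).
Proof.
move=> /locL1P[mf f_int]; apply/locL1P; split=> [|K Kc]; first exact: measurable_funM.
by have := integrableZl _ k (f_int K Kc); apply; exact: compact_measurable.
Qed.

Lemma locL1_norm f : locL1 f -> locL1 (fun x => `|f x|).
Proof.
move=> /locL1P[mf f_int]; apply/locL1P; split=> [|K Kc]; first exact: measurableT_comp.
exact: integrable_norm (f_int K Kc).
Qed.

Lemma locL1_sum (I : Type) (r : seq I) (h : I -> R -> R) :
  (forall i, locL1 (h i)) -> locL1 (fun x => \sum_(i <- r) h i x).
Proof.
move=> h_int; elim: r => [|i r IHr].
  by under eq_fun do rewrite big_nil; exact: locL1_cst.
by under eq_fun do rewrite big_cons; exact: locally_integrableD.
Qed.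

Lemma locL1_continuousM f g : continuous f -> locL1 g -> locL1 (fun x => f x * g x).
Proof.
move=> f_cont /locL1P[mg g_int]; apply/locL1P; split=> [|K Kc].
  by apply: measurable_funM => //; exact: continuous_measurable_fun.
have [C C0 fC] := @continuous_bounded_on_compact _ R^o R^o _ _ Kc
  (continuous_subspaceT f_cont).
have mK := compact_measurable Kc.
have Cg_int : mu.-integrable K (EFin \o (fun x => C * `|g x|)).
  by have := integrableZl _ C (integrable_norm (g_int K Kc)); apply.
apply: (le_integrable _ _ _ Cg_int) => //.
  apply/measurable_EFinP; apply: measurable_funM; last exact: measurable_funS mg.
  exact: measurable_funS (continuous_measurable_fun f_cont).
by move=> x Kx; rewrite /= lee_fin !normrM normr_id ler_wpM2r// (ger0_norm C0) fC.
Qed.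

Definition locL2 f : Prop := measurable_fun [set: R] f /\ locL1 (fun x => f x ^+ 2).

Lemma continuous_locL2 f : continuous f -> locL2 f.
Proof.
move=> f_cont; split; first exact: continuous_measurable_fun.
by apply: continuous_locL1 => x; apply: cvgM; exact: f_cont.
Qed.

Lemma locL2M f g : locL2 f -> locL2 g -> locL1 (fun x => f x * g x).
Proof.
move=> [mf f_L2] [mg g_L2]; apply: (@locL1_le _ (fun x => f x ^+ 2 + g x ^+ 2)).
- exact: measurable_funM.
- move=> x; rewrite normrM -(real_normK (num_real (f x))) -(real_normK (num_real (g x))).
  have := sqr_ge0 (`|f x| - `|g x|).
  by have := sqr_ge0 (`|f x|); have := sqr_ge0 (`|g x|); nra.
- exact: locally_integrableD.
Qed.

Lemma locL2_locL1 f : locL2 f -> locL1 f.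
Proof.
move=> f_L2; have one_L2 : locL2 (cst 1) by apply: continuous_locL2 => x; exact: cvg_cst.
by have := locL2M f_L2 one_L2; congr locally_integrable; apply/funext => x; rewrite mulr1.
Qed.

Lemma locL2D f g : locL2 f -> locL2 g -> locL2 (fun x => f x + g x).
Proof.
move=> [mf f_L2] [mg g_L2]; split; first exact: measurable_funD.
apply: (@locL1_le _ (fun x => 2 * (f x ^+ 2 + g x ^+ 2))).
- by apply: measurable_funX; exact: measurable_funD.
- by move=> x; rewrite ger0_norm ?sqr_ge0//; have := sqr_ge0 (f x - g x); nra.
- by apply: locL1Z; exact: locally_integrableD.
Qed.

Lemma locL2Z k f : locL2 f -> locL2 (fun x => k * f x).
Proof.
move=> [mf f_L2]; split; first exact: measurable_funM.
by under eq_fun do rewrite exprMn; exact: locL1Z.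
Qed.

Lemma locL2_sum (I : Type) (r : seq I) (h : I -> R -> R) :
  (forall i, locL2 (h i)) -> locL2 (fun x => \sum_(i <- r) h i x).
Proof.
move=> h_L2; elim: r => [|i r IHr].
  by under eq_fun do rewrite big_nil; apply: continuous_locL2 => x; exact: cvg_cst.
by under eq_fun do rewrite big_cons; exact: locL2D.
Qed.

Lemma L2_patch_locL2 a b f : L2 a b f -> locL2 (f \_ `]a, b[).
Proof.
move=> [mf f_L2]; split; first by apply/measurable_restrict => //; rewrite setTI.
have := integrable_locally (measurable_itv _) f_L2.
congr locally_integrable; apply/funext => x; rewrite !patchE.
by case: ifP => // _; rewrite expr0n.
Qed.

End LocallyIntegrable.

Section IntegralsOverSegments.
Context {R : realType}.
Implicit Types (f g h : R -> R) (a b s t r k : R).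

Lemma IntD f g s t : locL1 f -> locL1 g ->
  Int s t (fun x => f x + g x) = Int s t f + Int s t g.
Proof. by move=> f_int g_int; apply: RintegralD => //; exact: locL1_itv. Qed.

Lemma IntZ k f s t : locL1 f -> Int s t (fun x => k * f x) = k * Int s t f.
Proof. by move=> f_int; apply: RintegralZl => //; exact: locL1_itv. Qed.

Lemma IntB f g s t : locL1 f -> locL1 g ->
  Int s t (fun x => f x - g x) = Int s t f - Int s t g.
Proof. by move=> f_int g_int; apply: RintegralB => //; exact: locL1_itv. Qed.

Lemma Int_sum (I : Type) (r : seq I) (h : I -> R -> R) s t :
  (forall i, locL1 (h i)) ->
  Int s t (fun x => \sum_(i <- r) h i x) = \sum_(i <- r) Int s t (h i).
Proof.
move=> h_int; elim: r => [|i r IHr].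
  rewrite big_nil; under eq_fun do rewrite big_nil.
  by rewrite /parameterized_integral Rintegral_cst// mul0r.
rewrite big_cons; under eq_fun do rewrite big_cons.
by rewrite IntD// ?IHr//; exact: locL1_sum.
Qed.

Lemma Int_le f g s t : locL1 f -> locL1 g ->
  (forall x, s <= x <= t -> f x <= g x) -> Int s t f <= Int s t g.
Proof.
by move=> /(locL1_itv s t) f_int /(locL1_itv s t) g_int fg; exact: le_Rintegral.
Qed.

Lemma Int_norm f s t : locL1 f -> `|Int s t f| <= Int s t (fun x => `|f x|).
Proof. by move=> f_int; apply: le_normr_Rintegral => //; exact: locL1_itv. Qed.

Lemma Int_cst k s t : s <= t -> Int s t (cst k) = k * (t - s).
Proof.
move=> st; rewrite /parameterized_integral Rintegral_cst//; congr (_ * _).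
rewrite [X in fine X](lebesgue_measure_itv `[s, t]) /= lte_fin.
by move: st; rewrite le_eqVlt => /predU1P[->|->//]; rewrite ltxx subrr.
Qed.

Lemma eq_Int f g s t : (forall x, s <= x <= t -> f x = g x) -> Int s t f = Int s t g.
Proof. by move=> fg; apply: eq_Rintegral => x; rewrite inE; exact: fg. Qed.

Lemma Int_eq0 f s t : (forall x, s <= x <= t -> f x = 0) -> Int s t f = 0.
Proof.
by move=> f0; rewrite (eq_Int f0) /parameterized_integral Rintegral_cst// mul0r.
Qed.

Lemma Int_cat f r s t : locL1 f -> r <= s -> s <= t -> Int r t f = Int r s f + Int s t f.
Proof.
move=> f_int rs st.
have := @Rintegral_itvB _ f (BLeft r) (BRight t) s (locL1_itv r t f_int).
rewrite !bnd_simp => /(_ rs st)/eqP; rewrite subr_eq => /eqP.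
rewrite /parameterized_integral => ->.
rewrite addrC; congr (_ + _); apply: Rintegral_itv_obnd_cbnd.
by apply: integrableS (locL1_itv s t f_int) => //; apply: subset_itvr; rewrite bnd_simp.
Qed.

Lemma Int_ge0 f s t : (forall x, 0 <= f x) -> 0 <= Int s t f.
Proof. by move=> f0; exact: Rintegral_ge0. Qed.

Definition vanishes_outside a b f : Prop := forall x, ~~ (a < x < b) -> f x = 0.

Lemma Int_vanishing f a b s t : vanishes_outside a b f -> t <= a \/ b <= s -> Int s t f = 0.
Proof.
move=> f_supp outside; apply: Int_eq0 => x /andP[sx xt]; apply: f_supp.
rewrite negb_and -!leNgt; case: outside => [ta|bs]; first by rewrite (le_trans xt ta).
by rewrite (le_trans bs sx) orbT.
Qed.

Lemma Int_support f a b s t : locL1 f -> vanishes_outside a b f ->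
  s <= a -> a <= b -> b <= t -> Int s t f = Int a b f.
Proof.
move=> f_int f_supp sa ab bt.
rewrite (Int_cat f_int sa (le_trans ab bt)) (Int_cat f_int ab bt).
by rewrite (Int_vanishing f_supp (or_introl (lexx a))) (Int_vanishing f_supp
  (or_intror (lexx b))) addr0 add0r.
Qed.

Lemma Int_le_support f a b s t : locL1 f -> vanishes_outside a b f ->
  (forall x, 0 <= f x) -> a <= b -> s <= t -> Int s t f <= Int a b f.
Proof.
move=> f_int f_supp f0 ab st; pose p := Num.min s a; pose q := Num.max t b.
have [ps pa] : p <= s /\ p <= a by rewrite !ge_min !lexx orbT.
have [tq bq] : t <= q /\ b <= q by rewrite !le_max !lexx orbT.
rewrite -(Int_support f_int f_supp pa ab bq) (Int_cat f_int ps (le_trans st tq)).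
by rewrite (Int_cat f_int st tq) addrCA lerDl addr_ge0// Int_ge0.
Qed.

Lemma Int_itvoo f s t : locL1 f -> \int[mu]_(x in `]s, t[) f x = Int s t f.
Proof.
move=> /(locL1_itv s t) f_int; rewrite Rintegral_itv_bndo_bndc.
  rewrite Rintegral_itv_obnd_cbnd//; apply: integrableS f_int => //; exact: subset_itv_oc_cc.
by apply: integrableS f_int => //; exact: subset_itv_oo_cc.
Qed.

Lemma Int_mean_value f k r s t : locL1 f -> s <= t ->
  (forall x, s <= x <= t -> `|f x - k| <= r) -> `|Int s t f - (t - s) * k| <= r * (t - s).
Proof.
move=> f_int st fk; have fk_int := locally_integrableB f_int (locL1_cst k).
rewrite [_ * k]mulrC -(Int_cst k st) -(IntB _ _ f_int (locL1_cst k)) -(Int_cst r st).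
apply: le_trans (Int_norm _ _ fk_int) _; apply: Int_le fk => //; last exact: locL1_cst.
exact: locL1_norm.
Qed.

Lemma integral_itvcc_Int f g a b : locL1 g -> (forall x, a < x < b -> f x = g x) ->
  (\int[mu]_(x in `[a, b]) (f x)%:E = (Int a b g)%:E)%E.
Proof.
move=> g_int fg; have /locL1P[mg _] := g_int.
have fg_itv : {in `]a, b[%classic, (fun x => (g x)%:E) =1 (fun x => (f x)%:E)}.
  by move=> x; rewrite inE/= in_itv/= => /fg ->.
have mg_itv (i : interval R) : measurable_fun [set` i] (fun x => (g x)%:E).
  by apply/measurable_EFinP; exact: measurable_funS mg.
have mf_oo : measurable_fun `]a, b[ (fun x => (f x)%:E).
  exact: eq_measurable_fun fg_itv (mg_itv `]a, b[).
have mf_oc : measurable_fun `]a, b] (fun x => (f x)%:E) by exact/emeasurable_fun_itv_bndo_bndcP.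
rewrite -integral_itv_obnd_cbnd// -integral_itv_bndo_bndc//.
rewrite /parameterized_integral /Rintegral fineK; last first.
  exact: integrable_fin_num (locL1_itv a b g_int).
rewrite -[RHS]integral_itv_obnd_cbnd; last exact: mg_itv.
rewrite -[RHS]integral_itv_bndo_bndc; last exact: mg_itv.
by apply: eq_integral => x /fg_itv.
Qed.

Lemma sqr_Int_le f s t : locL2 f -> s <= t ->
  (Int s t f) ^+ 2 <= (t - s) * Int s t (fun x => f x ^+ 2).
Proof.
move=> f_L2 st; have f_int := locL2_locL1 f_L2; have [_ ff_int] := f_L2.
have [<-|s_neq_t] := eqVneq s t.
  by rewrite subrr mul0r /parameterized_integral set_itv1 Rintegral_set1 expr0n.
have ts0 : 0 < t - s by rewrite subr_gt0 lt_neqAle s_neq_t.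
pose m := Int s t f / (t - s).
have : 0 <= Int s t (fun x => f x ^+ 2 - (2 * m * f x - m ^+ 2)).
  by apply: Int_ge0 => x; have := sqr_ge0 (f x - m); lra.
have mf_int : locL1 (fun x => 2 * m * f x) by exact: locL1Z.
have mfm_int : locL1 (fun x => 2 * m * f x - m ^+ 2).
  exact: locally_integrableB mf_int (locL1_cst _).
rewrite IntB// (IntB _ _ mf_int (locL1_cst _)) IntZ// Int_cst//.
have -> : 2 * m * Int s t f - m ^+ 2 * (t - s) = Int s t f ^+ 2 / (t - s).
  by rewrite /m; field; rewrite gt_eqF.
by rewrite subr_ge0 ler_pdivrMr// mulrC.
Qed.

End IntegralsOverSegments.

Lemma additive_increments_eq0 {R : realType} (incr len : R -> R -> R) (a b : R) :
  (forall r s t, r <= s -> s <= t -> incr r t = incr r s + incr s t) ->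
  (forall r s t, r <= s -> s <= t -> len r t = len r s + len s t) ->
  (forall e, 0 < e -> exists2 r, 0 < r & forall s t, a <= s -> s <= t -> t <= b ->
    t - s <= r -> `|incr s t| <= e * len s t) ->
  a <= b -> incr a b = 0.
Proof.
move=> incr_add len_add incr_small ab.
have incr_le e : 0 < e -> `|incr a b| <= e * len a b.
  move=> e0; have [r r0 r_small] := incr_small e e0.
  have multiple (k : nat) s t : a <= s -> s <= t -> t <= b -> t - s <= k.+1%:R * r ->
      `|incr s t| <= e * len s t.
    elim: k s t => [|k IHk] s t as_ st tb; first by rewrite mul1r; exact: r_small.
    move=> ts_le; have [ts_r|r_ts] := leP (t - s) r; first exact: r_small.
    have [s_sr sr_t] : s <= s + r /\ s + r <= t by split; lra.
    rewrite (incr_add _ _ _ s_sr sr_t) (len_add _ _ _ s_sr sr_t) mulrDr.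
    apply: le_trans (ler_normD _ _) (lerD _ _); first by apply: r_small => //; lra.
    apply: IHk => //; first by lra.
    by move: ts_le; rewrite -[k.+2]addn1 natrD mulrDl mul1r; lra.
  apply: (multiple (Num.truncn ((b - a) / r))) => //.
  by rewrite -ler_pdivrMr//; apply: ltW; exact: truncnS_gt.
apply/eqP; rewrite -normr_le0; apply/ler_addgt0Pr => e e0; rewrite add0r.
have len1_gt0 : 0 < `|len a b| + 1 by rewrite ltr_wpDl.
apply: le_trans (incr_le (e / (`|len a b| + 1)) (divr_gt0 e0 len1_gt0)) _.
rewrite mulrAC ler_pdivrMr// ler_pM2l//.
by apply: le_trans (ler_norm _) _; rewrite lerDl.
Qed.

Section Primitives.
Context {R : realType}.
Implicit Types (F G f g : R -> R) (s t k : R).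

(* [F] is locally absolutely continuous with derivative [f] almost everywhere. *)
Definition is_primitive F f : Prop :=
  locL1 f /\ forall s t, s <= t -> F t - F s = Int s t f.

Lemma is_primitive_is_derive F f : continuous f -> is_primitive F f ->
  forall s : R, is_derive s 1 F (f s).
Proof.
move=> f_cont [f_int FE] s; apply: is_derive_increments => e e0.
have /cvgrPdistC_le/(_ e e0)/nbhs_ballP[d d0 fd] := f_cont s.
apply: filterS (nbhsx_ballx s _ d0) => t std.
have f_close r : `|s - r| <= `|s - t| -> `|f r - f s| <= e.
  by move=> sr; apply: fd; exact: le_lt_trans sr std.
have [st|/ltW ts] := leP s t.
  rewrite (ger0_norm (_ : 0 <= t - s)) ?subr_ge0//.
  rewrite FE//; apply: Int_mean_value => // r /andP[sr rt]; apply: f_close.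
  by rewrite (distrC s) (distrC s t) !ger0_norm ?subr_ge0//; lra.
rewrite distrC (distrC t) (ger0_norm (_ : 0 <= s - t)) ?subr_ge0//.
have -> : (t - s) *: f s - (F t - F s) = F s - F t - (s - t) * f s.
  by rewrite [_ *: _]mulrC; ring.
rewrite FE//; apply: Int_mean_value => // r /andP[tr rs]; apply: f_close.
by rewrite !ger0_norm ?subr_ge0//; lra.
Qed.

Lemma is_derive_is_primitive F f : continuous f ->
  (forall s : R, is_derive s 1 F (f s)) -> is_primitive F f.
Proof.
move=> f_cont F_derive; split=> [|s t]; first exact: continuous_locL1.
rewrite le_eqVlt => /predU1P[->|st].
  by rewrite /parameterized_integral set_itv1 Rintegral_set1 subrr.
have F_cont := is_derive_continuous F_derive.
rewrite /parameterized_integral /Rintegral (@continuous_FTC2 _ f F)//.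
- exact: continuous_subspaceT.
- split=> //; [exact/cvg_at_right_filter/F_cont|exact/cvg_at_left_filter/F_cont].
- by move=> x _; rewrite derive1E; exact: derive_val.
Qed.

Lemma is_primitive_Int f (a : R) : locL1 f -> (forall s, s <= a -> f s = 0) ->
  is_primitive (Int a ^~ f) f.
Proof.
move=> f_int f0; split=> // s t st.
have Int0 p q : q <= a -> Int p q f = 0.
  by move=> qa; apply: Int_eq0 => x /andP[_ xq]; apply: f0; exact: le_trans xq qa.
have [as_|/ltW sa] := leP a s; first by rewrite (Int_cat f_int as_ st); ring.
have [at_|/ltW ta] := leP a t; last by rewrite !Int0 ?subrr.
by rewrite (Int_cat f_int sa at_) (Int0 _ s)// (Int0 s a)// subr0 add0r.
Qed.

Lemma is_primitive_continuous F f : is_primitive F f -> continuous F.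
Proof.
move=> [f_int Ff] s.
have [as_ sb] : s - 1 < s /\ s < s + 1 by split; lra.
have ab : s - 1 <= s + 1 by lra.
have : {within `[s - 1, s + 1], continuous F}.
  apply: (@subspace_eq_continuous _ _ _ (fun t => F (s - 1) + Int (s - 1) t f)).
    by move=> t; rewrite inE/= in_itv/= => /andP[/Ff <- _]; rewrite subrKC.
  have Int_cont := parameterized_integral_continuous ab (locL1_itv _ _ f_int).
  by move=> t; apply: cvgD; [exact: cvg_cst|exact: Int_cont].
by move/within_continuous_continuous; apply; [exact: lt_trans sb|rewrite in_itv/= as_ sb].
Qed.

Lemma is_primitiveD F G f g : is_primitive F f -> is_primitive G g ->
  is_primitive (fun s => F s + G s) (fun s => f s + g s).
Proof.
move=> [f_int Ff] [g_int Gg]; split=> [|s t st]; first exact: locally_integrableD.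
by rewrite IntD// -Ff// -Gg//; ring.
Qed.

Lemma is_primitiveZ k F f : is_primitive F f ->
  is_primitive (fun s => k * F s) (fun s => k * f s).
Proof.
move=> [f_int Ff]; split=> [|s t st]; first exact: locL1Z.
by rewrite IntZ// -Ff// mulrBr.
Qed.

Lemma is_primitive_sum (I : Type) (r : seq I) (F f : I -> R -> R) :
  (forall i, is_primitive (F i) (f i)) ->
  is_primitive (fun s => \sum_(i <- r) F i s) (fun s => \sum_(i <- r) f i s).
Proof.
move=> Ff; split=> [|s t st]; first by apply: locL1_sum => i; have [] := Ff i.
rewrite Int_sum; last by move=> i; have [] := Ff i.
by rewrite -sumrB; apply: eq_bigr => i _; have [_ ->] := Ff i.
Qed.

Lemma midvalue_uniform (h : R -> R) (a b e : R) : continuous h -> 0 < e ->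
  exists2 r, 0 < r & forall s t, a <= s -> t <= b -> t - s <= r ->
    forall x, s <= x <= t -> `|(h s + h t) / 2 - h x| <= e.
Proof.
move=> h_cont e0.
have [r r0 rh] := @compact_uniform_continuous R R^o R^o `[a, b]%classic h e
  (@segment_compact _ _ _) (continuous_subspaceT h_cont) e0.
exists r => // s t as_ tb ts x /andP[sx xt].
have close y : s <= y <= t -> `|h y - h x| <= e.
  move=> /andP[sy yt]; apply: rh; rewrite /= ?in_itv/= ?(le_trans as_)//= ?(le_trans _ tb)//.
  by rewrite ler_norml; apply/andP; split; lra.
have hs : `|h s - h x| <= e by apply: close; rewrite lexx (le_trans sx xt).
have ht : `|h t - h x| <= e by apply: close; rewrite lexx (le_trans sx xt).
have -> : (h s + h t) / 2 - h x = 2^-1 * ((h s - h x) + (h t - h x)) by field.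
by rewrite normrM ger0_norm//; have := ler_normD (h s - h x) (h t - h x); lra.
Qed.

(* On a short interval, the increment of [F G] is the integral of [f] and [g]
   against the averages of the end values of [G] and [F]. *)
Lemma is_primitiveM_increment_le F G f g (e : R) s t :
  is_primitive F f -> is_primitive G g -> s <= t ->
  (forall x, s <= x <= t -> `|(F s + F t) / 2 - F x| <= e) ->
  (forall x, s <= x <= t -> `|(G s + G t) / 2 - G x| <= e) ->
  `|F t * G t - F s * G s - Int s t (fun x => G x * f x + F x * g x)| <=
    e * Int s t (fun x => `|f x| + `|g x|).
Proof.
move=> Ff Gg st; have [[f_int FfE] [g_int GgE]] := (Ff, Gg).
set mF := (F s + F t) / 2; set mG := (G s + G t) / 2 => F_osc G_osc.
have mult_int (h k : R -> R) : continuous h -> locL1 k -> locL1 (fun x => h x * k x).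
  exact: locL1_continuousM.
have mid_int (h k : R -> R) (c : R) : is_primitive h k -> continuous (fun x => c - h x).
  by move=> /is_primitive_continuous h_cont x; apply: cvgB; [exact: cvg_cst|exact: h_cont].
have Gf_int := mult_int _ _ (is_primitive_continuous Gg) f_int.
have Fg_int := mult_int _ _ (is_primitive_continuous Ff) g_int.
have mGf_int := mult_int _ _ (mid_int _ _ mG Gg) f_int.
have mFg_int := mult_int _ _ (mid_int _ _ mF Ff) g_int.
have dev_int := locally_integrableD mGf_int mFg_int.
have -> : F t * G t - F s * G s - Int s t (fun x => G x * f x + F x * g x) =
    Int s t (fun x => (mG - G x) * f x + (mF - F x) * g x).
  transitivity (Int s t (fun x => mG * f x + mF * g x) -
                Int s t (fun x => G x * f x + F x * g x)).
    rewrite (IntD _ _ (locL1Z mG f_int) (locL1Z mF g_int)) !IntZ//.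
    by rewrite -FfE// -GgE// /mG /mF; field.
  rewrite -IntB; [|by apply: locally_integrableD; exact: locL1Z|exact: locally_integrableD].
  by apply: eq_Int => x _; ring.
have fg_int := locally_integrableD (locL1_norm f_int) (locL1_norm g_int).
apply: le_trans (Int_norm _ _ dev_int) _; rewrite -IntZ//; apply: Int_le.
- exact: locL1_norm.
- exact: locL1Z.
- move=> x x_st; apply: le_trans (ler_normD _ _) _; rewrite !normrM mulrDr.
  by apply: lerD; rewrite ler_wpM2r// ?G_osc ?F_osc.
Qed.

Lemma is_primitiveM F G f g : is_primitive F f -> is_primitive G g ->
  is_primitive (fun s => F s * G s) (fun s => G s * f s + F s * g s).
Proof.
move=> Ff Gg; have [F_cont G_cont] := (is_primitive_continuous Ff, is_primitive_continuous Gg).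
have [[f_int _] [g_int _]] := (Ff, Gg).
have fg_int := locally_integrableD (locL1_norm f_int) (locL1_norm g_int).
have prod_int := locally_integrableD (locL1_continuousM G_cont f_int)
  (locL1_continuousM F_cont g_int).
split=> // a b ab; apply/eqP; rewrite -subr_eq0; apply/eqP.
apply: (@additive_increments_eq0 _ (fun s t => F t * G t - F s * G s -
    Int s t (fun x => G x * f x + F x * g x)) (fun s t => Int s t (fun x => `|f x| + `|g x|)))
  => // [r s t rs st|r s t rs st|e e0].
- by rewrite (Int_cat prod_int rs st); ring.
- exact: Int_cat.
have [p p0 F_mid] := midvalue_uniform a b F_cont e0.
have [q q0 G_mid] := midvalue_uniform a b G_cont e0.
exists (Num.min p q) => [|s t as_ st tb]; first by rewrite lt_min p0.
rewrite le_min => /andP[ts_p ts_q].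
by apply: is_primitiveM_increment_le => //; [exact: F_mid|exact: G_mid].
Qed.

End Primitives.

Section Clamp.
Context {R : realType}.
Implicit Types a b s t : R.

Definition clamp a b s : R := Num.max a (Num.min b s).

Lemma clamp_itv a b s : a <= b -> a <= clamp a b s <= b.
Proof. by move=> ab; rewrite /clamp le_max lexx/= ge_max ab ge_min lexx. Qed.

Lemma clamp_id a b s : a <= s <= b -> clamp a b s = s.
Proof. by rewrite /clamp => /andP[as_ sb]; rewrite (min_idPr sb) (max_idPr as_). Qed.

Lemma clamp_le a b s : a <= b -> s <= a -> clamp a b s = a.
Proof. by move=> ab sa; rewrite /clamp; apply: max_l; rewrite ge_min sa orbT. Qed.

Lemma clamp_ge a b s : a <= b -> b <= s -> clamp a b s = b.
Proof. by move=> ab bs; rewrite /clamp min_l// max_r. Qed.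

Lemma clamp_continuous a b : continuous (clamp a b).
Proof.
move=> s; apply: continuous_max; first exact: cvg_cst.
by apply: continuous_min; [exact: cvg_cst|exact: cvg_id].
Qed.

Lemma comp_clamp_continuous (V : topologicalType) a b (f : R -> V) : a <= b ->
  {within `[a, b], continuous f} -> continuous (f \o clamp a b).
Proof.
move=> ab /subspace_continuousP f_cont s N Nf.
have clamp_in t : `[a, b]%classic (clamp a b t) by rewrite /= in_itv/= clamp_itv.
have near_clamp : \forall t \near s, `[a, b]%classic (clamp a b t) -> N (f (clamp a b t)).
  exact: clamp_continuous (f_cont _ (clamp_in s) N Nf).
by apply: filterS near_clamp => t; apply.
Qed.

End Clamp.

Section WeakDerivatives.
Context {R : realType}.
Implicit Types (D f g th phi : R -> R) (a b c d e r s t x y : R).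

Lemma unit_bump x r : 0 < r -> exists th, [/\ continuous th, forall s, 0 <= th s,
  vanishes_outside (x - r) (x + r) th & Int (x - r) (x + r) th = 1].
Proof.
move=> r0; pose tent s := Num.max 0 (r - `|s - x|).
have tent_cont : continuous tent.
  move=> s; apply: (@continuous_max _ _ (fun=> 0) (fun s => r - `|s - x|)); first exact: cvg_cst.
  apply: cvgB; first exact: cvg_cst.
  by apply: (@cvg_norm _ R^o); apply: cvgB; [exact: cvg_id|exact: cvg_cst].
have tent0 s : 0 <= tent s by rewrite le_max lexx.
have tent_supp : vanishes_outside (x - r) (x + r) tent.
  move=> s; rewrite -ltr_distlC -leNgt distrC => rs.
  by rewrite /tent max_l// subr_le0.
pose m := Int (x - r) (x + r) tent.
have m0 : 0 < m.
  have half0 : 0 < r / 2 by rewrite divr_gt0.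
  have core_le : x - r / 2 <= x + r / 2 by lra.
  have core : r / 2 * r <= Int (x - r / 2) (x + r / 2) tent.
    have <- : Int (x - r / 2) (x + r / 2) (cst (r / 2)) = r / 2 * r.
      by rewrite Int_cst//; field.
    apply: Int_le => [||s]; first exact: locL1_cst.
      exact: continuous_locL1.
    rewrite -ler_distlC distrC => xs; rewrite le_max; apply/orP; right => /=; lra.
  apply: lt_le_trans (mulr_gt0 half0 r0) (le_trans core _).
  by apply: Int_le_support tent_supp tent0 _ core_le; [exact: continuous_locL1|lra].
exists (fun s => m^-1 * tent s); split.
- by move=> s; apply: cvgMl_tmp; exact: tent_cont.
- by move=> s; rewrite mulr_ge0// invr_ge0 ltW.
- by move=> s /tent_supp ->; rewrite mulr0.
- by rewrite IntZ ?mulVf ?gt_eqF//; exact: continuous_locL1.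
Qed.

Lemma averaging_bump a b D x e : continuous D -> a < x -> x < b -> 0 < e ->
  exists c d th, [/\ a < c <= d, d < b, continuous th,
    vanishes_outside c d th & Int a b th = 1 /\ `|Int a b (fun s => D s * th s) - D x| <= e].
Proof.
move=> D_cont ax xb e0.
have /cvgrPdistC_le/(_ e e0)/nbhs_ballP[q q0 D_near] := D_cont x.
pose r := Num.min (q / 2) (Num.min ((x - a) / 2) ((b - x) / 2)).
have r0 : 0 < r by rewrite !lt_min !divr_gt0// subr_gt0.
have [rq ra rb] : [/\ r <= q / 2, r <= (x - a) / 2 & r <= (b - x) / 2].
  by rewrite !ge_min !lexx !orbT.
have [th [th_cont th0 th_supp th_mass]] := unit_bump x r0.
have th_int := continuous_locL1 th_cont.
have {}th_mass : Int a b th = 1 by rewrite (Int_support th_int th_supp)//; lra.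
exists (x - r), (x + r), th; split=> //; [by apply/andP; split; lra|by lra|split=> //].
have Dth_int := locL1_continuousM D_cont th_int.
have dev_int : locL1 (fun s => D s * th s - D x * th s).
  exact: locally_integrableB Dth_int (locL1Z _ th_int).
rewrite -[D x]mulr1 -th_mass -IntZ// -IntB//; last exact: locL1Z.
apply: le_trans (Int_norm _ _ dev_int) _.
rewrite -[leRHS]mulr1 -th_mass -IntZ//.
apply: Int_le => [||s _]; [exact: locL1_norm|exact: locL1Z|].
rewrite -mulrBl normrM (ger0_norm (th0 s)).
have [xs|/th_supp ->] := boolP (x - r < s < x + r); last by rewrite !mulr0.
apply: ler_wpM2r => //; apply: D_near; rewrite /ball/= ltr_distlC.
by case/andP: xs => ? ?; apply/andP; split; lra.
Qed.

Lemma test_function_Int a b c d th : a < c <= d -> d < b -> continuous th ->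
  vanishes_outside c d th -> Int a b th = 0 ->
  test_function a b (Int a ^~ th) /\ derive1 (Int a ^~ th) = th.
Proof.
move=> /andP[ac cd] db th_cont th_supp th_mean0.
have th_int := continuous_locL1 th_cont.
have th_le_a s : s <= a -> th s = 0.
  by move=> sa; apply: th_supp; rewrite negb_and -leNgt (le_trans sa (ltW ac)).
have phi_derive := is_primitive_is_derive th_cont (is_primitive_Int th_int th_le_a).
have phi'E : derive1 (Int a ^~ th) = th.
  by apply/funext => s; rewrite derive1E; have [] := phi_derive s.
have phi_supp : vanishes_outside c d (Int a ^~ th).
  move=> s; rewrite negb_and -!leNgt => /orP[sc|ds].
    by rewrite (Int_vanishing th_supp)//; left.
  by rewrite (Int_support th_int th_supp (ltW ac) cd ds)
    -(Int_support th_int th_supp (ltW ac) cd (ltW db)).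
have supp_sub : closure [set s | Int a s th != 0] `<=` `[c, d].
  have seg_closed : closed `[c, d]%classic by exact: itv_closed.
  rewrite [X in _ `<=` X](closure_id _).1//; apply: closureS => s /=.
  apply: contraNT => s_out; apply/eqP/phi_supp; apply: contra s_out.
  by rewrite in_itv/= => /andP[/ltW -> /ltW ->].
split=> //; split=> [s|||s /supp_sub].
- by have [] := phi_derive s.
- by rewrite phi'E.
- by apply: subclosed_compact supp_sub; [exact: closed_closure|exact: segment_compact].
- by rewrite /= !in_itv/= => /andP[cs sd]; rewrite (lt_le_trans ac cs) (le_lt_trans sd db).
Qed.

(* Two points are compared by testing against the primitive of the difference of unit
   bumps around them. *)
Lemma du_bois_reymond a b D : continuous D ->
  (forall phi, test_function a b phi -> Int a b (fun s => D s * derive1 phi s) = 0) ->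
  forall x y, a < x < b -> a < y < b -> D x = D y.
Proof.
move=> D_cont D_weak x y /andP[ax xb] /andP[ay yb].
apply/eqP; rewrite -subr_eq0 -normr_le0; apply/ler_addgt0Pr => e e0; rewrite add0r.
have e2 : 0 < e / 2 by rewrite divr_gt0.
have [c [d [th [/andP[ac cd] db th_cont th_supp [th_mass th_avg]]]]] :=
  averaging_bump D_cont ax xb e2.
have [c' [d' [th' [/andP[ac' cd'] db' th'_cont th'_supp [th'_mass th'_avg]]]]] :=
  averaging_bump D_cont ay yb e2.
have [th_int th'_int] := (continuous_locL1 th_cont, continuous_locL1 th'_cont).
pose psi s := th s - th' s.
have psi_cont : continuous psi by move=> s; apply: cvgB; [exact: th_cont|exact: th'_cont].
have psi_supp : vanishes_outside (Num.min c c') (Num.max d d') psi.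
  move=> s s_out; rewrite /psi th_supp ?th'_supp ?subrr//; apply: contra s_out.
    by rewrite gt_min lt_max => /andP[-> ->]; rewrite !orbT.
  by rewrite gt_min lt_max => /andP[-> ->].
have psi_mean0 : Int a b psi = 0 by rewrite IntB// th_mass th'_mass subrr.
have [||phi_test phi'E] := test_function_Int _ _ psi_cont psi_supp psi_mean0.
- by rewrite lt_min ac ac'/= ge_min le_max cd.
- by rewrite gt_max db db'.
have := D_weak _ phi_test; rewrite phi'E.
under eq_fun do rewrite mulrBr.
rewrite IntB; [|exact: locL1_continuousM..] => /eqP; rewrite subr_eq0 => /eqP avg_eq.
move: th_avg; rewrite avg_eq distrC => th_avg.
have -> : D x - D y = (D x - Int a b (fun s => D s * th' s)) +
    (Int a b (fun s => D s * th' s) - D y) by rewrite addrA subrK.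
by apply: le_trans (ler_normD _ _) _; lra.
Qed.

Lemma continuous_constant_itv a b D : continuous D -> a < b ->
  (forall x y, a < x < b -> a < y < b -> D x = D y) ->
  forall x y, a <= x <= b -> a <= y <= b -> D x = D y.
Proof.
move=> D_cont ab D_const.
have [am mb] : a < (a + b) / 2 /\ (a + b) / 2 < b by split; lra.
suff D_mid x : a <= x <= b -> D x = D ((a + b) / 2).
  by move=> x y /D_mid -> /D_mid ->.
move=> /andP[]; rewrite le_eqVlt => /predU1P[<- _|ax].
  apply: (cvg_unique (@norm_hausdorff _ R^o) (cvg_at_right_filter (D_cont a))).
  apply: cvg_near_cst; near=> s; apply: D_const; last by rewrite am.
  by apply/andP; split; near: s; [exact: nbhs_right_gt|exact: nbhs_right_lt].
rewrite le_eqVlt => /predU1P[->|xb]; last by apply: D_const; rewrite ?ax ?am.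
apply: (cvg_unique (@norm_hausdorff _ R^o) (cvg_at_left_filter (D_cont b))).
apply: cvg_near_cst; near=> s; apply: D_const; last by rewrite am.
by apply/andP; split; near: s; [exact: nbhs_left_gt|exact: nbhs_left_lt].
Unshelve. all: by end_near. Qed.

Lemma test_function_eq0 a b phi : test_function a b phi -> vanishes_outside a b phi.
Proof.
move=> [_ _ _ phi_supp] x; apply: contraNeq => phix.
have : closure [set s | phi s != 0] x by apply: subset_closure.
by move=> /phi_supp; rewrite /= in_itv.
Qed.

Lemma test_function_primitive a b phi : test_function a b phi -> is_primitive phi (derive1 phi).
Proof.
move=> [phi_derivable phi'_cont _ _]; apply: is_derive_is_primitive => // s.
by rewrite derive1E; exact/derivableP.
Qed.

Section WeakDerivativePrimitive.
Variables (a b : R) (f g : R -> R).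
Hypotheses (ab : a < b) (f_cont : {within `[a, b], continuous f}).
Hypotheses (g_L2 : L2 a b g) (f_weak : weak_derivative a b f g).

Let F := f \o clamp a b.
Let g0 := g \_ `]a, b[.
Let G := Int a ^~ g0.

Let F_cont : continuous F. Proof. by apply: comp_clamp_continuous => //; exact: ltW. Qed.

Let g0_int : locL1 g0. Proof. exact/locL2_locL1/L2_patch_locL2. Qed.

Let g0_supp : vanishes_outside a b g0.
Proof. by move=> x xab; rewrite /g0 patchE mem_setE in_itv/= (negbTE xab). Qed.

Let G_prim : is_primitive G g0.
Proof. by apply: is_primitive_Int => // s sa; rewrite g0_supp// negb_and -leNgt sa. Qed.

Let G_cont : continuous G. Proof. exact: is_primitive_continuous G_prim. Qed.

Lemma weak_derivative_orthogonal phi : test_function a b phi ->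
  Int a b (fun s => (F s - G s) * derive1 phi s) = 0.
Proof.
move=> phi_test; have [_ phi'_cont _ _] := phi_test.
have phi_prim := test_function_primitive phi_test.
have phi_supp := test_function_eq0 phi_test.
have [phia phib] : phi a = 0 /\ phi b = 0 by rewrite !phi_supp// ltxx ?andbF.
have phi'_int := continuous_locL1 phi'_cont.
have Fphi'_int := locL1_continuousM F_cont phi'_int.
have Gphi'_int := locL1_continuousM G_cont phi'_int.
have phig_int := locL1_continuousM (is_primitive_continuous phi_prim) g0_int.
have [_ /(_ a b (ltW ab))] := is_primitiveM G_prim phi_prim.
rewrite phia phib !mulr0 subrr IntD// => by_parts.
under eq_fun do rewrite mulrBl.
rewrite IntB//; have := f_weak phi_test.
have -> : \int[mu]_(s in `]a, b[) (f s * derive1 phi s) = Int a b (fun s => F s * derive1 phi s).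
  rewrite -Int_itvoo//; apply: eq_Rintegral => s; rewrite inE/= in_itv/= => /andP[as_ sb].
  by rewrite /F/= clamp_id// (ltW as_) (ltW sb).
have -> : \int[mu]_(s in `]a, b[) (g s * phi s) = Int a b (fun s => phi s * g0 s).
  by rewrite -Int_itvoo//; apply: eq_Rintegral => s sab; rewrite /g0 patchE sab mulrC.
by lra.
Qed.

Lemma weak_derivative_primitive : is_primitive F g0.
Proof.
have D_cont : continuous (fun s => F s - G s).
  by move=> s; apply: cvgB; [exact: F_cont|exact: G_cont].
have D_const := continuous_constant_itv D_cont ab
  (du_bois_reymond D_cont weak_derivative_orthogonal).
have F_clamp s : F (clamp a b s) = F s.
  by rewrite /F/= (clamp_id (clamp_itv s (ltW ab))).
have G_clamp s : G (clamp a b s) = G s.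
  have [sa|/ltW as_] := leP s a.
    by rewrite clamp_le ?(ltW ab)// /G !(Int_vanishing g0_supp)//; left.
  have [sb|/ltW bs] := leP s b; first by rewrite clamp_id ?as_.
  by rewrite clamp_ge ?(ltW ab)// /G [RHS](Int_support g0_int g0_supp (lexx a) (ltW ab) bs).
split=> // s t st; have [_ GE] := G_prim; rewrite -(GE s t st).
have := D_const _ _ (clamp_itv s (ltW ab)) (clamp_itv t (ltW ab)).
by rewrite !F_clamp !G_clamp; lra.
Qed.

End WeakDerivativePrimitive.
End WeakDerivatives.

Section DampedMotion.
Context {R : realType} {n : nat}.
Local Notation X := 'cV[R]_n.+1.
Variables (A B : 'M[R]_n.+1) (f : X -> R).

(* Newton's equation [A w'' + B w' + grad f w = 0] as a first-order system in the
   phase space of pairs [(w, w')]. *)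
Definition newton_field (z : X * X) : X * X :=
  (z.2, - (invmx A *m (B *m z.2 + grad f z.1))).

Definition mech_energy (z : X * X) : R := f z.1 + 2^-1 * dot z.2 (A *m z.2).

Definition damped_heteroclinic (y : R -> X) (a b : X) : Prop :=
  [/\ forall s : R,
        [/\ derivable y s 1, derivable (derive1 y) s 1
          & A *m derive1 (derive1 y) s + B *m derive1 y s + grad f (y s) = 0],
      y s @[s --> -oo] --> a,
      y s @[s --> +oo] --> b,
      derive1 y s @[s --> -oo] --> (0 : X)
    & derive1 y s @[s --> +oo] --> (0 : X)].

Hypotheses (A_spd : sym_posdef A) (B_spd : sym_posdef B).
Hypothesis f_diff : forall x, differentiable f x.
Hypothesis gradf_cont : continuous (grad f).

Lemma newton_fieldE z : A *m (newton_field z).2 = - (B *m z.2 + grad f z.1).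
Proof. by rewrite mulmxN mulKVmx ?posdef_unitmx. Qed.

Lemma mech_energy_rest x : mech_energy (x, 0) = f x.
Proof. by rewrite /mech_energy/= dot0l mulr0 addr0. Qed.

Lemma mech_energy_continuous : continuous mech_energy.
Proof.
move=> z; have [fst_cvg snd_cvg] := cvg_components (@cvg_id _ (nbhs z)).
apply: cvgD; first exact: (cvg_comp _ _ fst_cvg (differentiable_continuous (f_diff _))).
apply: cvgMl_tmp; apply: cvg_dot; first exact: snd_cvg.
exact: (cvg_comp _ _ snd_cvg (@mulmx_continuous _ _ _ _ A _)).
Qed.

Lemma newton_field_continuous : continuous newton_field.
Proof.
move=> z; have [fst_cvg snd_cvg] := cvg_components (@cvg_id _ (nbhs z)).
have z_filter : Filter (nbhs z) := nbhs_filter z.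
have force_cvg : B *m y.2 + grad f y.1 @[y --> z] --> B *m z.2 + grad f z.1.
  apply: cvgD; first exact: (cvg_comp _ _ snd_cvg (@mulmx_continuous _ _ _ _ B _)).
  exact: (cvg_comp _ _ fst_cvg (@gradf_cont _)).
have acc_cvg : - (invmx A *m (B *m y.2 + grad f y.1)) @[y --> z] -->
    - (invmx A *m (B *m z.2 + grad f z.1)).
  by apply: cvgN; exact: (cvg_comp _ _ force_cvg (@mulmx_continuous _ _ _ _ (invmx A) _)).
exact: (cvg_pair snd_cvg acc_cvg).
Qed.

Lemma newton_equilibriaP z : equilibria newton_field z <-> z.2 = 0 /\ grad f z.1 = 0.
Proof.
have invA_eq0 x : invmx A *m x = 0 -> x = 0.
  by move=> x0; rewrite -(mulKVmx (posdef_unitmx A_spd) x) x0 mulmx0.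
rewrite /equilibria/= /newton_field.
split=> [[p0 /eqP]|[-> ->]]; last by rewrite mulmx0 add0r mulmx0 oppr0.
by rewrite p0 mulmx0 add0r oppr_eq0 => /eqP/invA_eq0.
Qed.

Lemma newton_equilibria_isolated :
  [set x | grad f x = 0] `<=` isolated [set x | grad f x = 0] ->
  equilibria newton_field `<=` isolated (equilibria newton_field).
Proof.
move=> crit_isolated z z_eq; have [z2 gz] := (newton_equilibriaP z).1 z_eq.
have [_ [N Nz NC]] := crit_isolated z.1 gz.
split; first exact: mem_set.
exists (fst @^-1` N); first exact: cvg_fst.
apply/seteqP; split=> [x [/= Nx /newton_equilibriaP[x2 gx]]|x ->]; last first.
  by split=> //=; exact: nbhs_singleton.
suff x1 : [set z.1] x.1 by rewrite [x]surjective_pairing [z]surjective_pairing /= x1 x2 z2.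
by rewrite -NC.
Qed.

Section Trajectory.
Variable z : R -> X * X.
Hypothesis z_derive : forall s : R, is_derive s 1 z (newton_field (z s)).

Lemma is_derive_position (s : R) : is_derive s 1 (fun t => (z t).1) (z s).2.
Proof. by have [] := is_derive_pair (z_derive s). Qed.

Lemma is_derive_velocity (s : R) : is_derive s 1 (fun t => (z t).2) (newton_field (z s)).2.
Proof. by have [] := is_derive_pair (z_derive s). Qed.

Lemma is_derive_mech_energy (s : R) :
  is_derive s 1 (mech_energy \o z) (- dot (z s).2 (B *m (z s).2)).
Proof.
have [w_derive p_derive] := (is_derive_position s, is_derive_velocity s).
have potential := is_derive_comp_grad (f_diff (z s).1) w_derive.
have kinetic := is_deriveZ 2^-1 (is_derive_dot p_derive (is_derive_mulmx A p_derive)).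
have := is_deriveD potential kinetic; move/is_derive_eq; apply.
rewrite -(posdef_dotC A_spd) newton_fieldE -mulr2n.
have halfK (c : R) : 2^-1 *: (c *+ 2 : R^o) = c.
  by change (2^-1 * (c *+ 2) = c); field.
by rewrite [X in _ + X]halfK dotNr dotDr (dotC (grad f _)); ring.
Qed.

Lemma mech_energy_strict : (forall s, mech_energy (z s) = mech_energy (z 0)) ->
  forall s, equilibria newton_field (z s).
Proof.
move=> E_const.
have p0 s : (z s).2 = 0.
  apply: (posdef_eq0 B_spd); have [_ E'] := is_derive_mech_energy s.
  rewrite -[LHS]opprK -E' (_ : _ \o _ = cst (mech_energy (z 0))) ?derive_cst ?oppr0//.
  by apply/funext => t; exact: E_const.
move=> s; have [_ acc] := is_derive_velocity s.
have p_const : (fun t => (z t).2) = cst 0 by apply/funext.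
rewrite /equilibria/= [newton_field _]surjective_pairing -acc p_const derive_cst.
by rewrite /newton_field/= p0.
Qed.

Lemma newton_heteroclinic (a b : X) :
  z s @[s --> -oo] --> (a, 0 : X) -> z s @[s --> +oo] --> (b, 0 : X) ->
  damped_heteroclinic (fun s => (z s).1) a b.
Proof.
move=> za zb.
have w' : derive1 (fun s => (z s).1) = (fun s => (z s).2).
  by apply/funext => s; rewrite derive1E; have [] := is_derive_position s.
rewrite /damped_heteroclinic w'; split.
- move=> s; have [w_derivable _] := is_derive_position s.
  have [p_derivable p'] := is_derive_velocity s.
  split; [exact: w_derivable|exact: p_derivable|].
  by rewrite derive1E p' newton_fieldE -addrA; exact: addNr.
- by have [] := cvg_components za.
- by have [] := cvg_components zb.
- by have [] := cvg_components za.
- by have [] := cvg_components zb.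
Qed.

End Trajectory.

Lemma newton_chain (u v : X) : heteroclinic_chain newton_field mech_energy (u, 0) (v, 0) ->
  exists (m : nat) (us : nat -> X) (vs : nat -> R -> X),
    [/\ us 0%N = u, us m = v, forall i, (i <= m)%N -> grad f (us i) = 0,
      forall i, (i < m)%N -> f (us i.+1) < f (us i)
    & forall i, (1 <= i <= m)%N -> damped_heteroclinic (vs i) (us i.-1) (us i)].
Proof.
move=> [m [us [vs [us0 usm us_eq us_lt vs_het]]]].
have us_rest i : (i <= m)%N -> us i = ((us i).1, 0) /\ grad f (us i).1 = 0.
  move=> /us_eq /newton_equilibriaP[p0 gx]; split=> //.
  by rewrite [LHS]surjective_pairing p0.
exists m, (fun i => (us i).1), (fun i s => (vs i s).1); split.
- by rewrite us0.
- by rewrite usm.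
- by move=> i /us_rest[].
- move=> i im; have [usi _] := us_rest i (ltnW im); have [usi1 _] := us_rest i.+1 im.
  by have := us_lt i im; rewrite usi usi1 !mech_energy_rest.
- move=> i /[dup] im /vs_het[z_derive]; have /andP[i1 i_le] := im.
  have [-> _] := us_rest i i_le.
  have [-> _] := us_rest i.-1 (leq_trans (leq_pred i) i_le).
  exact: newton_heteroclinic.
Qed.

End DampedMotion.

Section VectorPrimitives.
Context {R : realType} {n : nat}.
Local Notation X := 'cV[R]_n.+1.
Implicit Types (h k dh dk : R -> X) (C : 'M[R]_n.+1).

Lemma continuous_locL2_entry h i : continuous h -> locL2 (fun s => h s i 0).
Proof. by move=> h_cont; apply: continuous_locL2 => s; apply: cvg_entry; exact: h_cont. Qed.

Lemma locL2_mulmx h C i : (forall j, locL2 (fun s => h s j 0)) ->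
  locL2 (fun s => (C *m h s) i 0).
Proof.
by move=> h_L2; under eq_fun do rewrite mxE; apply: locL2_sum => j; exact: locL2Z.
Qed.

Lemma locL1_dot h k : (forall i, locL2 (fun s => h s i 0)) ->
  (forall i, locL2 (fun s => k s i 0)) -> locL1 (fun s => dot (h s) (k s)).
Proof. by move=> h_L2 k_L2; apply: locL1_sum => i; exact: locL2M. Qed.

Lemma is_primitive_mulmx h dh C i :
  (forall j, is_primitive (fun s => h s j 0) (fun s => dh s j 0)) ->
  is_primitive (fun s => (C *m h s) i 0) (fun s => (C *m dh s) i 0).
Proof.
move=> h_prim; under eq_fun do rewrite mxE; under [X in is_primitive _ X]eq_fun do rewrite mxE.
by apply: is_primitive_sum => j; exact: is_primitiveZ.
Qed.

Lemma is_primitive_dot h dh k dk :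
  (forall i, is_primitive (fun s => h s i 0) (fun s => dh s i 0)) ->
  (forall i, is_primitive (fun s => k s i 0) (fun s => dk s i 0)) ->
  is_primitive (fun s => dot (h s) (k s)) (fun s => dot (dh s) (k s) + dot (h s) (dk s)).
Proof.
move=> h_prim k_prim; under [X in is_primitive _ X]eq_fun do rewrite -big_split/=.
apply: is_primitive_sum => i; have := is_primitiveM (h_prim i) (k_prim i).
by under [X in is_primitive _ X]eq_fun do rewrite [k _ i 0 * _]mulrC.
Qed.

End VectorPrimitives.

Section Curves.
Context {R : realType} {n : nat}.
Local Notation X := 'cV[R]_n.+1.
Variables (A B : 'M[R]_n.+1) (f : X -> R).
Hypotheses (A_spd : sym_posdef A) (B_spd : sym_posdef B).
Hypothesis f_diff : forall x, differentiable f x.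
Hypothesis gradf_cont : continuous (grad f).

(* Curves of class W^{2,2}, with velocity [P] and acceleration [Q]. *)
Definition curve (W P Q : R -> X) : Prop :=
  [/\ forall s : R, is_derive s 1 W (P s), continuous P,
      forall i, locL2 (fun s => Q s i 0)
    & forall i, is_primitive (fun s => P s i 0) (fun s => Q s i 0)].

Definition residual (W P Q : R -> X) (s : R) : X := grad f (W s) + A *m Q s + B *m P s.

Definition residual_density (W P Q : R -> X) (s : R) : R :=
  2^-1 * dot (residual W P Q s) (invmx B *m residual W P Q s).

Lemma residual_density_ge0 W P Q s : 0 <= residual_density W P Q s.
Proof. by rewrite mulr_ge0//; exact/posdef_ge0/posdef_invmx. Qed.

Lemma lagrangianE (W P Q : R -> X) s : lagrangian A B f W P Q s =
  dot (grad f (W s) + A *m Q s) (invmx B *m (grad f (W s) + A *m Q s)) +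
  dot (P s) (B *m P s).
Proof. by rewrite /lagrangian sqr_qnorm ?sqr_qnorm//; exact: posdef_invmx. Qed.

Lemma residual_densityE W P Q s : residual_density W P Q s =
  2^-1 * lagrangian A B f W P Q s + dot (residual W P Q s - B *m P s) (P s).
Proof.
rewrite lagrangianE /residual_density /residual addrK.
move: (grad f (W s) + A *m Q s) => z.
rewrite mulmxDr mulKmx ?posdef_unitmx// !(dotDl, dotDr).
rewrite (posdef_dotC (posdef_invmx B_spd) (B *m P s) z) mulKmx ?posdef_unitmx//.
by rewrite (dotC (B *m P s)); field.
Qed.

Lemma residual_entry_le (C : 'M[R]_n.+1) W P Q s i : (C *m residual W P Q s) i 0 ^+ 2 <=
  2 * (n.+1%:R * `|C|) ^+ 2 * `|invmx (invmx B)| * residual_density W P Q s.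
Proof.
have res_le := posdef_norm_le (posdef_invmx B_spd) (residual W P Q s).
have Cres_le : `|(C *m residual W P Q s) i 0| <= n.+1%:R * `|C| * `|residual W P Q s|.
  exact: le_trans (entry_le_mx_norm _ i 0) (mulmx_norm_le _ _).
rewrite -real_normK ?num_real//.
apply: le_trans (_ : (n.+1%:R * `|C| * `|residual W P Q s|) ^+ 2 <= _).
  by rewrite ler_sqr ?nnegrE ?mulr_ge0.
have -> : 2 * (n.+1%:R * `|C|) ^+ 2 * `|invmx (invmx B)| * residual_density W P Q s =
    (n.+1%:R * `|C|) ^+ 2 *
    (`|invmx (invmx B)| * dot (residual W P Q s) (invmx B *m residual W P Q s)).
  by rewrite /residual_density; field.
by rewrite exprMn ler_wpM2l// sqr_ge0.
Qed.

Section Curve.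
Variables W P Q : R -> X.
Hypothesis W_curve : curve W P Q.

Let W_cont : continuous W.
Proof. by have [W_derive _ _ _] := W_curve; exact: is_derive_continuous W_derive. Qed.

Let P_cont : continuous P. Proof. by case: W_curve. Qed.

Let Q_locL2 i : locL2 (fun s => Q s i 0). Proof. by case: W_curve. Qed.

Let P_locL2 i : locL2 (fun s => P s i 0). Proof. exact: continuous_locL2_entry. Qed.

Let gradW_cont : continuous (fun s => grad f (W s)).
Proof. by move=> s; exact: (cvg_comp _ _ (@W_cont s) (@gradf_cont _)). Qed.

Let force_locL2 i : locL2 (fun s => (grad f (W s) + A *m Q s) i 0).
Proof.
under eq_fun do rewrite mxE; apply: locL2D; last exact: locL2_mulmx.
exact: (@continuous_locL2_entry _ _ (fun s => grad f (W s))).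
Qed.

Lemma residual_locL2 i : locL2 (fun s => residual W P Q s i 0).
Proof. by under eq_fun do rewrite mxE; apply: locL2D => //; exact: locL2_mulmx. Qed.

Lemma residual_density_locL1 : locL1 (residual_density W P Q).
Proof.
apply: locL1Z; apply: locL1_dot; first exact: residual_locL2.
by move=> i; apply: locL2_mulmx; exact: residual_locL2.
Qed.

Lemma lagrangian_locL1 : locL1 (lagrangian A B f W P Q).
Proof.
rewrite (funext (lagrangianE W P Q)).
have quad := locL1_dot force_locL2 (fun i => locL2_mulmx (invmx B) i force_locL2).
exact: locally_integrableD quad (locL1_dot P_locL2 (fun i => locL2_mulmx B i P_locL2)).
Qed.

Lemma mech_energy_primitive : is_primitive (fun s => mech_energy A f (W s, P s))
  (fun s => dot (residual W P Q s - B *m P s) (P s)).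
Proof.
have [W_derive _ _ P_prim] := W_curve.
have potential : is_primitive (f \o W) (fun s => dot (grad f (W s)) (P s)).
  apply: is_derive_is_primitive => s; last exact: is_derive_comp_grad.
  by apply: cvg_dot; [exact: gradW_cont|exact: P_cont].
have kinetic := is_primitiveZ 2^-1 (is_primitive_dot P_prim
  (fun i => is_primitive_mulmx A i P_prim)).
have := is_primitiveD potential kinetic; congr is_primitive; apply/funext => s.
by rewrite /residual addrK dotDl (posdef_dotC A_spd (Q s)) (dotC (A *m _)); field.
Qed.

(* Completing the square in the action. *)
Lemma lagrangian_Int s t : s <= t -> 2^-1 * Int s t (lagrangian A B f W P Q) =
  Int s t (residual_density W P Q) + mech_energy A f (W s, P s) - mech_energy A f (W t, P t).
Proof.
move=> st; have [power_int E_incr] := mech_energy_primitive.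
have -> : residual_density W P Q = (fun s => 2^-1 * lagrangian A B f W P Q s +
    dot (residual W P Q s - B *m P s) (P s)) by apply/funext => r; exact: residual_densityE.
rewrite (IntD _ _ (locL1Z _ lagrangian_locL1) power_int) (IntZ _ _ _ lagrangian_locL1).
by rewrite -E_incr//; ring.
Qed.

Lemma mech_energy_le s t : s <= t -> mech_energy A f (W t, P t) <=
  mech_energy A f (W s, P s) + Int s t (residual_density W P Q).
Proof.
move=> /lagrangian_Int; suff : 0 <= Int s t (lagrangian A B f W P Q) by lra.
by apply: Int_ge0 => r; rewrite addr_ge0 ?sqr_ge0.
Qed.

Let acc i s := (newton_field A B f (W s, P s)).2 i 0.

Let accE i s : Q s i 0 = acc i s + (invmx A *m residual W P Q s) i 0.
Proof.
suff {1}-> : Q s = (newton_field A B f (W s, P s)).2 + invmx A *m residual W P Q s.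
  by rewrite mxE.
rewrite /newton_field/= addrC -mulmxBr /residual opprD addrA addrK [grad f _ + _]addrC addrK.
by rewrite mulKmx// posdef_unitmx.
Qed.

Let perturbation_locL1 i : locL1 (fun s => (invmx A *m residual W P Q s) i 0).
Proof. by apply/locL2_locL1/locL2_mulmx; exact: residual_locL2. Qed.

Lemma newton_acceleration_locL1 i : locL1 (acc i).
Proof.
have := locally_integrableB (locL2_locL1 (Q_locL2 i)) (perturbation_locL1 i).
by congr locally_integrable; apply/funext => s; rewrite /= accE addrK.
Qed.

Lemma curve_velocity_increment i s t : s <= t -> P t i 0 - P s i 0 =
  Int s t (acc i) + Int s t (fun r => (invmx A *m residual W P Q r) i 0).
Proof.
have [_ _ _ P_prim] := W_curve; have [_ PE] := P_prim i.
move=> /PE ->; under eq_fun do rewrite accE.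
by rewrite IntD//; exact: newton_acceleration_locL1.
Qed.

End Curve.

Lemma residual_Int_le (C : 'M[R]_n.+1) (d : R) : 0 < d -> exists2 eps, 0 < eps &
  forall W P Q i s t, curve W P Q -> s <= t <= s + 1 ->
    Int s t (residual_density W P Q) <= eps ->
    `|Int s t (fun r => (C *m residual W P Q r) i 0)| <= d.
Proof.
move=> d0; pose k := 2 * (n.+1%:R * `|C|) ^+ 2 * `|invmx (invmx B)|.
have k0 : 0 <= k by rewrite !mulr_ge0// sqr_ge0.
have k1_gt0 : 0 < k + 1 by rewrite ltr_wpDl.
exists (d ^+ 2 / (k + 1)); first by rewrite divr_gt0// exprn_gt0.
move=> W P Q i s t W_curve /andP[st ts]; rewrite ler_pdivlMr// => density_le.
have density_int := residual_density_locL1 W_curve.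
have Cres_L2 := locL2_mulmx C i (residual_locL2 W_curve).
have density0 : 0 <= Int s t (residual_density W P Q).
  by apply: Int_ge0 => r; exact: residual_density_ge0.
rewrite -ler_sqr ?nnegrE ?(ltW d0)// real_normK ?num_real//.
apply: le_trans (sqr_Int_le Cres_L2 st) _.
have Cres_le : Int s t (fun r => (C *m residual W P Q r) i 0 ^+ 2) <=
    k * Int s t (residual_density W P Q).
  rewrite -IntZ//; apply: Int_le => [||r _]; [by case: Cres_L2|exact: locL1Z|].
  exact: residual_entry_le.
have sqr_int0 : 0 <= Int s t (fun r => (C *m residual W P Q r) i 0 ^+ 2).
  by apply: Int_ge0 => r; exact: sqr_ge0.
apply: le_trans (ler_piMl sqr_int0 _) (le_trans Cres_le _); first by lra.
by move: density_le; rewrite mulrDr mulr1 mulrC; lra.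
Qed.

Lemma curve_mean_value (d : R) : 0 < d -> exists2 eps, 0 < eps & forall W P Q,
  curve W P Q -> (forall s t, s <= t -> Int s t (residual_density W P Q) <= eps) ->
  mean_value_inequality_upto (newton_field A B f) d (fun s => (W s, P s)).
Proof.
move=> d0; have [eps eps0 res_le] := residual_Int_le (invmx A) d0.
exists eps => // W P Q W_curve density_le s t [cw cp] e /[dup] st_le1 /andP[st _] field_near.
have [W_derive P_cont _ _] := W_curve.
have e0 : 0 <= e by apply: le_trans (field_near s _); rewrite ?normr_ge0// lexx st.
have bound0 : 0 <= e * (t - s) + d by rewrite addr_ge0 ?(ltW d0)// mulr_ge0// subr_ge0.
have field_near_entries r i : s <= r <= t -> `|P r i 0 - cw i 0| <= e /\
    `|(newton_field A B f (W r, P r)).2 i 0 - cp i 0| <= e.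
  move=> /field_near; rewrite prod_normE ge_max => /andP[near_w near_p].
  have entry_w := entry_le_mx_norm (P r - cw) i 0.
  have entry_p := entry_le_mx_norm ((newton_field A B f (W r, P r)).2 - cp) i 0.
  rewrite mxE [X in _ + X]mxE in entry_w; rewrite mxE [X in _ + X]mxE in entry_p.
  by split; [exact: le_trans entry_w near_w|exact: le_trans entry_p near_p].
have P_int i : locL1 (fun r => P r i 0) by exact/locL2_locL1/continuous_locL2_entry.
have W_prim i : is_primitive (fun r => W r i 0) (fun r => P r i 0).
  apply: is_derive_is_primitive => r; first by apply: cvg_entry; exact: P_cont.
  by have /is_derive_mxP := W_derive r; exact.
rewrite prod_normE ge_max; apply/andP; split; apply: mx_norm_le => // i j; rewrite ord1 !mxE.
- have [_ ->//] := W_prim i; apply: (@le_trans _ _ (e * (t - s))); last by rewrite lerDl ltW.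
  by apply: Int_mean_value => // r /(field_near_entries _ i)[].
- rewrite (curve_velocity_increment W_curve)// addrAC.
  apply: le_trans (ler_normD _ _) (lerD _ _); last first.
    exact: res_le W_curve st_le1 (density_le _ _ st).
  apply: Int_mean_value => // [|r /(field_near_entries _ i)[] //].
  exact: newton_acceleration_locL1 W_curve _.
Qed.

Lemma curve_pseudo_orbit (K : set (X * X)) : compact K -> exists rho : R -> R,
  [/\ forall e, 0 < e -> 0 < rho e, forall e, rho e <= 1
    & forall dl, 0 < dl -> exists2 eps, 0 < eps & forall W P Q : R -> X,
      curve W P Q -> (forall s, K (W s, P s)) ->
      (forall s t, s <= t -> Int s t (residual_density W P Q) <= eps) ->
      pseudo_orbit (newton_field A B f) (mech_energy A f) K rho dl (fun s => (W s, P s))].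
Proof.
move=> K_compact; have [rho [rho_gt0 rho_le1 rhoP]] := perturbed_trajectory_pseudo_orbit
  (mech_energy A f) K_compact (@newton_field_continuous _ _ A B _ gradf_cont).
exists rho; split=> // dl dl0; have [d d0 z_po] := rhoP dl dl0.
have [eps eps0 z_mvi] := curve_mean_value d0.
exists (Num.min eps dl); first by rewrite lt_min eps0.
move=> W P Q W_curve WPK density_le; apply: z_po => // [s t st|].
  apply: le_trans (mech_energy_le W_curve st) _; rewrite lerD2l.
  by apply: le_trans (density_le s t st) _; rewrite ge_min lexx orbT.
apply: z_mvi W_curve _ => s t st.
by apply: le_trans (density_le s t st) _; rewrite ge_min lexx.
Qed.

End Curves.

Section Admissible.
Context {R : realType} {n : nat}.
Local Notation X := 'cV[R]_n.+1.
Variables (A B : 'M[R]_n.+1) (f : X -> R).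
Hypotheses (A_spd : sym_posdef A) (B_spd : sym_posdef B).
Hypothesis f_diff : forall x, differentiable f x.
Hypothesis gradf_cont : continuous (grad f).
Variables (N : nat) (u v : X) (w dw ddw : R -> X).
Hypotheses (N_gt0 : (0 < N)%N) (w_adm : admissible N u v w dw ddw).
Hypotheses (u_crit : grad f u = 0) (v_crit : grad f v = 0).

Let a : R := - N%:R.
Let b : R := N%:R.

Let ab : a < b. Proof. by rewrite /a /b gtrN// ltr0n. Qed.

(* Extension of the trajectory to the real line by rest at [u] and at [v]. *)
Let W := w \o clamp a b.
Let P := dw \o clamp a b.
Let Q s := if s \in `]a, b[%classic then ddw s else 0.

Let rest_left s : s <= a -> W s = u /\ P s = 0.
Proof. by move=> sa; rewrite /W /P/= clamp_le// ?(ltW ab)//; case: w_adm. Qed.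

Let rest_right s : b <= s -> W s = v /\ P s = 0.
Proof. by move=> sb; rewrite /W /P/= clamp_ge// ?(ltW ab)//; case: w_adm. Qed.

Let entry_within (h : R -> X) i : {within `[a, b], continuous h} ->
  {within `[a, b], continuous (fun s => h s i 0)}.
Proof.
move=> /subspace_continuousP h_cont; apply/subspace_continuousP => s s_ab.
exact: cvg_entry (h_cont s s_ab).
Qed.

Lemma admissible_curve : curve W P Q.
Proof.
have [[w_cont dw_cont w_W12] _ _ _ _] := w_adm.
have P_cont : continuous P := comp_clamp_continuous (ltW ab) dw_cont.
have patchP i : (fun s => dw s i 0) \_ `]a, b[ = (fun s => P s i 0).
  apply/funext => s; rewrite patchE mem_setE; case: ifPn; rewrite in_itv/=.
    by case/andP=> /ltW as_ /ltW sb; rewrite /P/= clamp_id// as_ sb.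
  by rewrite negb_and -!leNgt => /orP[/rest_left|/rest_right] [_ ->]; rewrite mxE.
have patchQ i : (fun s => ddw s i 0) \_ `]a, b[ = (fun s => Q s i 0).
  by apply/funext => s; rewrite patchE /Q; case: ifP => // _; rewrite mxE.
split=> //.
- move=> s; apply/is_derive_mxP => i j; rewrite ord1.
  have [[_ dw_L2 dw_weak] _] := w_W12 i.
  have := weak_derivative_primitive ab (entry_within w_cont) dw_L2 dw_weak.
  rewrite patchP => /is_primitive_is_derive; apply=> r.
  by apply: cvg_entry; exact: P_cont.
- by move=> i; rewrite -patchQ; apply: L2_patch_locL2; have [_ []] := w_W12 i.
- move=> i; rewrite -patchQ; have [_ [_ ddw_L2 ddw_weak]] := w_W12 i.
  exact: weak_derivative_primitive ab (entry_within dw_cont) ddw_L2 ddw_weak.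
Qed.

Let density_supp : vanishes_outside a b (residual_density A B f W P Q).
Proof.
move=> s s_out; have Q0 : Q s = 0.
  by rewrite /Q ifF//; apply/negbTE; rewrite mem_setE in_itv.
suff res0 : residual A B f W P Q s = 0 by rewrite /residual_density res0 dot0l mulr0.
rewrite /residual Q0; move: s_out; rewrite negb_and -!leNgt.
by move=> /orP[/rest_left|/rest_right] [-> ->]; rewrite ?u_crit ?v_crit !mulmx0 !addr0.
Qed.

Lemma action_residual : action A B f N w dw ddw =
  (Int a b (residual_density A B f W P Q) + (f u - f v))%:E.
Proof.
have w_lag s : a < s < b -> lagrangian A B f w dw ddw s = lagrangian A B f W P Q s.
  move=> /[dup] /andP[as_ sb] s_ab; rewrite /lagrangian /W /P /Q/= mem_setE in_itv/= s_ab.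
  by rewrite clamp_id// !ltW.
have W_lag_int := lagrangian_locL1 A B_spd gradf_cont admissible_curve.
rewrite /action (integral_itvcc_Int W_lag_int w_lag) -EFinM; congr EFin.
rewrite (lagrangian_Int A_spd B_spd f_diff gradf_cont admissible_curve (ltW ab)).
have [[-> ->] [-> ->]] := (rest_left (lexx a), rest_right (lexx b)).
by rewrite !mech_energy_rest addrA.
Qed.

Lemma admissible_extension : exists W P Q : R -> X,
  [/\ curve W P Q, forall s, s <= a -> W s = u /\ P s = 0,
      forall s, b <= s -> W s = v /\ P s = 0
    & forall s t, s <= t -> ((Int s t (residual_density A B f W P Q))%:E <=
        action A B f N w dw ddw - (f u - f v)%:E)%E].
Proof.
exists W, P, Q; split=> // [|s t st]; first exact: admissible_curve.
rewrite action_residual -EFinB lee_fin addrK.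
apply: Int_le_support density_supp _ (ltW ab) st => [|r].
  exact: (residual_density_locL1 A B gradf_cont admissible_curve).
exact: residual_density_ge0.
Qed.

End Admissible.

Lemma gronwall {R : realType} (g g' : R -> R) (k a b : R) : a <= b ->
  {within `[a, b], continuous g} ->
  (forall s, a < s < b -> is_derive s 1 g (g' s) /\ g' s <= k * g s) ->
  g b <= g a * expR (k * (b - a)).
Proof.
move=> ab g_cont g_derive; pose h s := g s * expR (- k * s).
have h_derive s : a < s < b -> is_derive s 1 h ((g' s - k * g s) * expR (- k * s)).
  move=> /g_derive[g'E _].
  have := is_deriveM g'E (is_derive_compM (is_derive_expR (- k * s))).
  move/is_derive_eq; apply.
  by change (g s * (- k * expR (- k * s)) + expR (- k * s) * g' s =
    (g' s - k * g s) * expR (- k * s)); ring.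
have h_le : h b <= h a.
  apply: (@ler0_derive1_le_cc _ h a b); rewrite ?in_itv/= ?lexx ?ab//.
  - by move=> s; rewrite in_itv/= => /h_derive[].
  - move=> s; rewrite in_itv/= => s_ab; have [_ g'_le] := g_derive s s_ab.
    rewrite derive1E; have [_ ->] := h_derive s s_ab.
    by rewrite mulr_le0_ge0 ?expR_ge0// subr_le0.
  - apply/subspace_continuousP => s s_ab; apply: cvgM.
      by have /subspace_continuousP := g_cont; exact.
    apply: cvg_within_filter; apply: (@continuous_comp _ _ _ (fun s => - k * s) expR).
      by apply: cvgMl_tmp; exact: cvg_id.
    exact: continuous_expR.
have := ler_wpM2r (expR_ge0 (k * b)) h_le; rewrite /h -!mulrA -!expRD mulNr addNr expR0 mulr1.
by rewrite (_ : - k * a + k * b = k * (b - a))//; ring.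
Qed.

Lemma gronwall_norm {R : realType} (g g' : R -> R) (k a b : R) : a <= b ->
  {within `[a, b], continuous g} ->
  (forall s, a < s < b -> is_derive s 1 g (g' s) /\ `|g' s| <= k * g s) ->
  g b <= g a * expR (k * (b - a)) /\ g a <= g b * expR (k * (b - a)).
Proof.
move=> ab g_cont g_derive; split.
  apply: (@gronwall _ g g') => // s /g_derive[g'E g'_le]; split=> //.
  exact: le_trans (ler_norm _) g'_le.
have : - g b <= - g a * expR (- k * (b - a)).
  apply: (@gronwall _ (\- g) (\- g')) => //; first by move=> s; apply: cvgN; exact: g_cont.
  move=> s /g_derive[g'E]; rewrite ler_norml => /andP[g'_ge _].
  by split; [exact: is_deriveN|rewrite mulrNN lerNl].
rewrite mulNr lerN2 => /(ler_wpM2r (expR_ge0 (k * (b - a)))).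
by rewrite -mulrA -expRD mulNr addNr expR0 mulr1.
Qed.

Lemma is_derive_within {R : realType} {V : normedModType R} (D : set R) (g : R -> V) (s : R) :
  nbhs s D -> derivable_within D g s -> is_derive s 1 g (derive_within D g s).
Proof.
move=> Ds /cvgrPdist_le g_quot; apply: is_derive_increments => e e0.
have := g_quot e e0; rewrite /derive_within; set l := lim _; rewrite /within/= => quot_near.
have {}quot_near : \forall r \near s, r != s -> D r ->
    `|l - difference_quotient g s r| <= e by exact: quot_near.
apply: filterS2 Ds quot_near => r Dr quot_r.
have [->|rs] := eqVneq r s; first by rewrite !subrr scale0r subrr !normr0 mulr0.
have rs0 : r - s != 0 by rewrite subr_eq0.
rewrite -[g r - g s](scalerKV rs0) -scalerBr normrZ mulrC ler_wpM2r//.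
by rewrite distrC; exact: quot_r.
Qed.

Section Sublevels.
Context {R : realType} {n : nat}.
Local Notation X := 'cV[R]_n.+1.
Variables (T : R) (F : R -> X -> R).
Hypothesis HF0 : F0 T F.

Lemma F_within_continuous (x : X) : {within `[0, T], continuous (F ^~ x)}.
Proof.
have [/subspace_continuousP F_cont _ _ _] := HF0.
apply/subspace_continuousP => s sT N NF.
have := F_cont (s, x) (conj sT I) N NF.
rewrite /fmap /within/= => -[[N1 N2] /= [N1s N2x] sub].
apply: filterS N1s => r N1r rT; apply: (sub (r, x)) => //=.
by split => //=; exact: nbhs_singleton.
Qed.

Lemma is_derive_F (x : X) s : 0 < s < T -> is_derive s 1 (F ^~ x) (dt_F T F s x).
Proof.
move=> s_in; have s_itv : `]0, T[%classic s by rewrite /= in_itv.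
apply: is_derive_within.
  apply: filterS (open_nbhs_nbhs (conj (itv_open_ends_open _) s_itv)) => //.
  exact: subset_itv_oo_cc.
have [_ F_derivable _ _] := HF0.
by have [] := F_derivable s x (subset_itv_oo_cc s_itv).
Qed.

Section Growth.
Variables C1 C2 : R.
Hypothesis C1_gt0 : 0 < C1.
Hypothesis dtF_le : forall t u, 0 <= t <= T -> `|dt_F T F t u| <= C1 * F t u + C2.

Let dtF_le_shift t u : 0 <= t <= T -> `|dt_F T F t u| <= C1 * (F t u + C2 / C1).
Proof.
by move=> /(@dtF_le t u); rewrite mulrDr [C1 * (C2 / C1)]mulrC divfK// gt_eqF.
Qed.

Lemma growth_ge0 t u : 0 <= t <= T -> 0 <= F t u + C2 / C1.
Proof. by move=> /(dtF_le_shift u)/(le_trans (normr_ge0 _)); rewrite pmulr_rge0. Qed.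

Lemma growth_le t r x : 0 <= t <= T -> 0 <= r <= T ->
  F r x + C2 / C1 <= (F t x + C2 / C1) * expR (C1 * T).
Proof.
have grow a b : 0 <= a -> a <= b -> b <= T ->
    F b x + C2 / C1 <= (F a x + C2 / C1) * expR (C1 * (b - a)) /\
    F a x + C2 / C1 <= (F b x + C2 / C1) * expR (C1 * (b - a)).
  move=> a0 ab bT.
  have g_cont : {within `[a, b], continuous (fun s => F s x + C2 / C1)}.
    apply: (@continuous_subspaceW _ _ _ `[0, T]) => [s /=|s].
      by rewrite !in_itv/= => /andP[as_ sb]; rewrite (le_trans a0 as_) (le_trans sb bT).
    by apply: cvgD; [exact: F_within_continuous|exact: cvg_cst].
  apply: (gronwall_norm ab g_cont (g' := fun s => dt_F T F s x)) => s /andP[as_ sb].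
  have s0 : 0 < s := le_lt_trans a0 as_; have sT : s < T := lt_le_trans sb bT.
  split; last by apply: dtF_le_shift; rewrite !ltW.
  have sT' : 0 < s < T by rewrite s0.
  have := is_deriveD (is_derive_F x sT') (is_derive_cst (C2 / C1) s 1).
  by move/is_derive_eq; apply; rewrite addr0.
move=> /[dup] tT /andP[t0 t_le] /andP[r0 r_le].
have exp_le a b : 0 <= a -> b <= T -> (F t x + C2 / C1) * expR (C1 * (b - a)) <=
    (F t x + C2 / C1) * expR (C1 * T).
  by move=> a0 bT; rewrite ler_wpM2l ?growth_ge0// ler_expR ler_pM2l//; lra.
have [tr|/ltW rt] := leP t r.
  by have [F_le _] := grow t r t0 tr r_le; exact: le_trans F_le (exp_le _ _ t0 r_le).
by have [_ F_le] := grow r t r0 rt t_le; exact: le_trans F_le (exp_le _ _ r0 t_le).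
Qed.

End Growth.

Hypotheses (HF1 : F1 T F) (HF2 : F2 T F).

Lemma F_bounded_below (t : R) : 0 <= t <= T -> exists C, forall x, - C <= F t x.
Proof.
move=> tT; have [C1 [C2 [C1_gt0 _ dtF_le]]] := HF2.
exists (C2 / C1) => x; rewrite -subr_ge0 opprK; exact: growth_ge0.
Qed.

Lemma F_sublevel_bounded (t rho : R) : 0 <= t <= T ->
  exists M, forall x, F t x <= rho -> `|x| <= M.
Proof.
move=> tT; have [C1 [C2 [C1_gt0 C2_gt0 dtF_le]]] := HF2.
have c0 : 0 < C2 / C1 by rewrite divr_gt0.
pose L := (`|rho| + C2 / C1) * expR (C1 * T) + C2 / C1.
have L0 : 0 < L by rewrite ltr_wpDl// mulr_ge0 ?expR_ge0// addr_ge0// ltW.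
have [M [_ MP]] := HF1 L0.
exists (M + 1) => x x_rho; apply: (MP (M + 1)); first by rewrite ltrDl.
apply: ge_ereal_sup => _ [s sT <-]; rewrite lee_fin.
have {}sT : 0 <= s <= T by move: sT; rewrite /= in_itv.
have F_le := growth_le C1_gt0 dtF_le x tT sT.
have F_ge := growth_ge0 C1_gt0 dtF_le x sT.
have rho_le : (F t x + C2 / C1) * expR (C1 * T) <= (`|rho| + C2 / C1) * expR (C1 * T).
  by rewrite ler_wpM2r ?expR_ge0// lerD2r; exact: le_trans x_rho (ler_norm _).
by rewrite ler_norml /L; apply/andP; split; lra.
Qed.

End Sublevels.

Section Connection.
Context {R : realType} {n : nat}.
Local Notation X := 'cV[R]_n.+1.
Variables (A B : 'M[R]_n.+1) (f : X -> R).
Hypotheses (A_spd : sym_posdef A) (B_spd : sym_posdef B).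

Lemma mech_energy_sublevel_bounded (L C : R) : (forall x, - C <= f x) ->
  (exists M, forall x, f x <= L -> `|x| <= M) ->
  exists M, forall z, mech_energy A f z <= L -> `|z.1| <= M /\ `|z.2| <= M.
Proof.
move=> f_ge [Mx MxP]; pose Mq := Num.sqrt (`|invmx A| * (2 * (L + C))).
exists (Num.max Mx Mq) => -[x q] /= E_le.
have q0 := posdef_ge0 A_spd q; have fx := f_ge x.
have f_le : f x <= L by move: E_le; rewrite /mech_energy/=; lra.
rewrite !le_max MxP//; split=> //; apply/orP; right.
rewrite -[leLHS]normr_id -sqrtr_sqr; apply: ler_wsqrtr.
apply: le_trans (posdef_norm_le A_spd q) _.
by rewrite ler_wpM2l//; move: E_le; rewrite /mech_energy/=; lra.
Qed.

Hypothesis f_diff : forall x, differentiable f x.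
Hypothesis gradf_cont : continuous (grad f).

Lemma cost_connects (u v : X) (C : R) :
  grad f u = 0 -> grad f v = 0 -> (forall x, - C <= f x) ->
  (exists M, forall x, f x <= f u + 1 -> `|x| <= M) ->
  (f u - f v)%:E = cost A B f u v ->
  exists rho K, [/\ compact K, forall e, 0 < e -> 0 < rho e, forall e, rho e <= 1
    & connects (newton_field A B f) (mech_energy A f) K rho (u, 0) (v, 0)].
Proof.
move=> u_crit v_crit f_ge f_coercive cost_uv.
have [M MP] := mech_energy_sublevel_bounded f_ge f_coercive.
pose K := [set x : X | `|x| <= M] `*` [set q : X | `|q| <= M].
have K_compact : compact K by apply: compact_setX; exact: col_ball_compact.
have [rho [rho_gt0 rho_le1 rhoP]] :=
  curve_pseudo_orbit A_spd B_spd f_diff gradf_cont K_compact.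
exists rho, K; split=> // dl dl0; have [eps eps0 curve_po] := rhoP dl dl0.
have min0 : 0 < Num.min eps 1 by rewrite lt_min eps0 ltr01.
have cost_fin : cost A B f u v \is a fin_num by rewrite -cost_uv.
have [_ [N [w [dw [ddw [N0 w_adm ->]]]]] action_lt] := lb_ereal_inf_adherent min0 cost_fin.
have [W [P [Q [W_curve W_left W_right density_le]]]] :=
  admissible_extension A_spd B_spd f_diff gradf_cont N0 w_adm u_crit v_crit.
have {}density_le s t : s <= t -> Int s t (residual_density A B f W P Q) <= Num.min eps 1.
  move=> st; rewrite -lee_fin; apply: le_trans (density_le s t st) _.
  rewrite leeBlDl//; apply: ltW; apply: lt_le_trans action_lt _.
  by rewrite -/(cost A B f u v) -cost_uv.
have WPK s : K (W s, P s).
  apply: MP; pose s0 := Num.min s (- N%:R).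
  have [s0s s0N] : s0 <= s /\ s0 <= - N%:R by rewrite !ge_min !lexx orbT.
  apply: le_trans (mech_energy_le A_spd B_spd f_diff gradf_cont W_curve s0s) _.
  have [-> ->] := W_left s0 s0N; rewrite mech_energy_rest lerD2l.
  by apply: le_trans (density_le _ _ s0s) _; rewrite ge_min lexx orbT.
exists (fun s => (W s, P s)); split.
- apply: curve_po W_curve WPK _ => s t /density_le /le_trans; apply.
  by rewrite ge_min lexx.
- by exists (- N%:R) => s /W_left[-> ->].
- by exists N%:R => s /W_right[-> ->].
Qed.

Lemma cost_chain (u v : X) (C : R) :
  grad f u = 0 -> grad f v = 0 -> (forall x, - C <= f x) ->
  (exists M, forall x, f x <= f u + 1 -> `|x| <= M) ->
  [set x | grad f x = 0] `<=` isolated [set x | grad f x = 0] ->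
  (f u - f v)%:E = cost A B f u v ->
  exists (m : nat) (us : nat -> X) (vs : nat -> R -> X),
    [/\ us 0%N = u, us m = v, forall i, (i <= m)%N -> grad f (us i) = 0,
      forall i, (i < m)%N -> f (us i.+1) < f (us i)
    & forall i, (1 <= i <= m)%N -> damped_heteroclinic A B f (vs i) (us i.-1) (us i)].
Proof.
move=> u_crit v_crit f_ge f_coercive crit_isolated cost_uv.
have [rho [K [K_compact rho_gt0 rho_le1 uv]]] :=
  cost_connects u_crit v_crit f_ge f_coercive cost_uv.
apply: (newton_chain A_spd (B := B)).
apply: (connects_chain K_compact) uv => //.
- exact: newton_field_continuous.
- exact: mech_energy_continuous.
- exact: mech_energy_strict.
- exact: newton_equilibria_isolated.
- by apply/newton_equilibriaP.
Qed.

End Connection.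

Theorem theorem5p13 (R : realType) (n : nat) (T : R) (A B : 'M[R]_n.+1)
    (F : R -> 'cV[R]_n.+1 -> R)
    (T_gt0 : 0 < T) (A_spd : sym_posdef A) (B_spd : sym_posdef B)
    (HF0 : F0 T F) (HF1 : F1 T F) (HF2 : F2 T F)
    (HF3 : F3 T F) (HF4 : F4 T F) (HF5 : F5 T F)
    (t : R) (t_in : 0 <= t <= T) (u v : 'cV[R]_n.+1)
    (u_crit : critical F t u) (v_crit : critical F t v)
    (cost_uv : (F t u - F t v)%:E = cost A B (F t) u v) :
  exists (m : nat) (us : nat -> 'cV[R]_n.+1) (vs : nat -> R -> 'cV[R]_n.+1),
    [/\ us 0%N = u, us m = v,
        forall i, (i <= m)%N -> critical F t (us i),
        forall i j, (i <= m)%N -> (j <= m)%N -> us i = us j -> i = j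
      & forall i, (1 <= i <= m)%N ->
          [/\ forall s : R,
                [/\ derivable (vs i) s 1, derivable (derive1 (vs i)) s 1
                  & A *m derive1 (derive1 (vs i)) s + B *m derive1 (vs i) s
                    + grad (F t) (vs i s) = 0],
              vs i s @[s --> -oo] --> us i.-1,
              vs i s @[s --> +oo] --> us i,
              derive1 (vs i) s @[s --> -oo] --> (0 : 'cV[R]_n.+1)
            & derive1 (vs i) s @[s --> +oo] --> (0 : 'cV[R]_n.+1)]].
Proof.
have tI : `[0, T]%classic t by rewrite /= in_itv.
have [/(_ t tI)[f_diff gradf_diff _] _] := HF4.
have gradf_cont : continuous (grad (F t)).
  by move=> x; apply: differentiable_continuous; exact: gradf_diff.
have [C F_ge] := F_bounded_below HF2 t_in.
have F_coercive := F_sublevel_bounded HF0 HF1 HF2 (F t u + 1) t_in.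
have [m [us [vs [us0 usm us_crit us_lt vs_het]]]] := cost_chain A_spd B_spd f_diff gradf_cont
  u_crit v_crit F_ge F_coercive (HF5 t tI) cost_uv.
exists m, us, vs; split=> // i j im jm.
have F_lt p q : (p < q)%N -> (q <= m)%N -> F t (us q) < F t (us p).
  elim: q => // q IHq; rewrite ltnS leq_eqVlt => /orP[/eqP ->|pq] qm; first exact: us_lt.
  by apply: lt_trans (us_lt q qm) (IHq pq (ltnW qm)).
by have [/F_lt/(_ jm)|/F_lt/(_ im)|//] := ltngtP i j => + ij; rewrite ij ltxx.
Qed.
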